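(* There exists an isomorphism of $\mathbb{Q}(v^{1/2})$-algebras $$\widetilde{\Phi}^{\mathrm{dbl}}:\widetilde{\mathcal H}(Q^{\mathrm{dbl}},\mathrm{swap})\longrightarrow D(\widetilde{\mathbf B}(Q)),\qquad (\mathfrak u_\lambda\oplus\mathfrak u_{\mu^\diamond})*\mathbb K_\alpha*\mathbb K_{\beta^\diamond}\longmapsto v^{(\mu+\alpha,\lambda+\beta)_Q-(\lambda,\mu)_Q}\,\mathfrak u_\lambda\cdot\mathbb K_{\beta^\diamond}\otimes\mathfrak u_\mu\cdot\mathbb K_{\alpha^\diamond},$$ for any $\lambda,\mu\in\mathfrak P$, $\alpha,\beta\in\mathbb Z^{\mathbb I}$.
   Context: Setting. $Q$ is a Dynkin quiver (underlying graph a simply-laced Dynkin diagram, type ADE) with vertex set $\mathbb I=\{1,\dots,n\}$. $\Phi^+$ is the set of positive roots, inside the root lattice $\mathbb Z^{\mathbb I}=\bigoplus_i\mathbb Z\alpha_i$. The Euler form is $\langle x,y\rangle_Q=\sum_i x_iy_i-\sum_{(i\to j)\in Q_1}x_iy_j$, and $(x,y)_Q=\langle x,y\rangle_Q+\langle y,x\rangle_Q$. For a finite field $\mathbb F_q$ and $\beta\in\Phi^+$, $M_q(\beta)$ is the indecomposable representation of $Q$ over $\mathbb F_q$ of dimension vector $\beta$. $\mathfrak P$ is the set of functions $\lambda:\Phi^+\to\mathbb N$; $M_q(\lambda)=\bigoplus_\beta M_q(\beta)^{\oplus\lambda(\beta)}$, with dimension vector $d^\lambda$. An element $\lambda\in\mathfrak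 P$ appearing in a bilinear form, in a sum with elements of $\mathbb Z^{\mathbb I}$, or as a subscript of $\mathbb K$ stands for $d^\lambda$. Hall polynomials. For modules $X,Y,Z$, $F_{XZ}^Y$ is the number of submodules $L\subseteq Y$ with $L\cong Z$, $Y/L\cong X$; $G_{XZ}^Y=|\mathrm{Ext}^1(X,Z)_Y|/|\mathrm{Hom}(X,Z)|$, where $\mathrm{Ext}^1(X,Z)_Y$ is the set of extension classes with middle term isomorphic to $Y$; $a_X=|\mathrm{Aut}(X)|$. There are $f_{\lambda,\mu}^{\nu}(v),g_{\lambda,\mu}^{\nu}(v),a_\lambda(v)\in\mathbb Z[v,v^{-1}]$ whose values at $v=\sqrt q$ are $F_{M_q(\lambda),M_q(\mu)}^{M_q(\nu)}$, $G_{M_q(\lambda),M_q(\mu)}^{M_q(\nu)}$, $a_{M_q(\lambda)}$ for every $q$. Generic iHall algebra. For a quiver $Q$ that is a (possibly disconnected) union of ADE Dynkin quivers with involution $\varrho$ (acting on roots, on $\mathbb Z^{\mathbb I}$, and on $\mathfrak P$ by $(\varrho\lambda)(\beta)=\lambda(\varrho\beta)$), $\widetilde{\mathcal H}(Q,\varrho)$ (generic version of the twisted semi-derived Ringel–Hall algebra of the iquiver algebra of $(Q,\varrho)$) is the associative unital $\mathbb Q(v^{1/2})$-algebra with basis $\{\mathbb K_\alpha*\mathfrak u_\lambda\mid\alpha\in\mathbb Z^{\mathbb I},\lambda\in\mathfrak P\}$ and multiplication determined by $\mathbb K_0=\mathfrak u_0=1$, $\mathbb K_\alpha*\mathbb K_\beta=\mathbb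 K_{\alpha+\beta}$, $\mathbb K_\alpha*\mathfrak u_\lambda=v^{(\varrho\alpha,\lambda)_Q-(\alpha,\lambda)_Q}\mathfrak u_\lambda*\mathbb K_\alpha$, and $$\mathfrak u_\lambda*\mathfrak u_\mu=\sum_{\theta,\nu,\gamma,\delta\in\mathfrak P}v^{\langle\delta,\theta\rangle_Q-\langle\varrho\delta,\theta\rangle_Q-\langle\lambda,\mu\rangle_Q+2\langle\nu,\gamma\rangle_Q}a_\delta(v)f^\lambda_{\delta,\nu}(v)f^\mu_{\gamma,\varrho\delta}(v)g^\theta_{\nu,\gamma}(v)\,\mathbb K_\delta*\mathfrak u_\theta.$$ Diagonal type. $Q^{\mathrm{dbl}}=Q\sqcup Q^\diamond$, where $Q^\diamond$ is a copy of $Q$ with vertices $i^\diamond$, and $\mathrm{swap}$ exchanges $i$ and $i^\diamond$. $\widetilde{\mathcal H}(Q^{\mathrm{dbl}},\mathrm{swap})$ is the associative unital $\mathbb Q(v^{1/2})$-algebra with basis $\{\mathbb K_\alpha*\mathfrak u_\lambda\mid\alpha\in\mathbb Z^{\mathbb I\sqcup\mathbb I^\diamond},\lambda\in\mathfrak P(Q^{\mathrm{dbl}})\}$, where $\mathbb I^\diamond=\{i^\diamond\mid i\in\mathbb I\}$ and $\mathfrak P(Q^{\mathrm{dbl}})$ is the set of $\mathbb N$-valued functions on the positive roots of $Q^{\mathrm{dbl}}$, and with multiplication determined by $\mathbb K_0=\mathfrak u_0=1$, $\mathbb K_\alpha*\mathbb K_\beta=\mathbb K_{\alpha+\beta}$,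 $\mathbb K_\alpha*\mathfrak u_\lambda=v^{(\mathrm{swap}\,\alpha,\lambda)_{Q^{\mathrm{dbl}}}-(\alpha,\lambda)_{Q^{\mathrm{dbl}}}}\mathfrak u_\lambda*\mathbb K_\alpha$, and $$\mathfrak u_\lambda*\mathfrak u_\mu=\sum_{\theta,\nu,\gamma,\delta\in\mathfrak P(Q^{\mathrm{dbl}})}v^{\langle\delta,\theta\rangle_{Q^{\mathrm{dbl}}}-\langle\mathrm{swap}\,\delta,\theta\rangle_{Q^{\mathrm{dbl}}}-\langle\lambda,\mu\rangle_{Q^{\mathrm{dbl}}}+2\langle\nu,\gamma\rangle_{Q^{\mathrm{dbl}}}}a_\delta(v)f^\lambda_{\delta,\nu}(v)f^\mu_{\gamma,\mathrm{swap}\,\delta}(v)g^\theta_{\nu,\gamma}(v)\,\mathbb K_\delta*\mathfrak u_\theta,$$ the Euler form and the Hall polynomials here being those of $Q^{\mathrm{dbl}}$. For $\lambda,\mu\in\mathfrak P=\mathfrak P(Q)$, $\mathfrak u_\lambda\oplus\mathfrak u_{\mu^\diamond}$ is the basis element corresponding to $M_q(\lambda)\oplus M_q(\mu)^\diamond$ (with $N^\diamond$ the copy of $N$ over $Q^\diamond$); for $\alpha,\beta\in\mathbb Z^{\mathbb I}$, $\mathbb K_\alpha$ and $\mathbb K_{\beta^\diamond}$ are the elements attached to the root lattices of $Q$ and $Q^\diamond$. The elements $(\mathfrak u_\lambda\oplus\mathfrak u_{\mu^\diamond})*\mathbb K_\alpha*\mathbb K_{\beta^\diamond}$ form a basis.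 The Hopf algebra $\widetilde{\mathbf B}(Q)$ (extended Hall algebra). It has $\mathbb Q(v^{1/2})$-basis $\{\mathfrak u_\lambda\cdot\mathbb K_{\alpha^\diamond}\mid\lambda\in\mathfrak P,\alpha\in\mathbb Z^{\mathbb I}\}$ with multiplication $\mathfrak u_\lambda\cdot\mathfrak u_\mu=\sum_\nu v^{\langle\lambda,\mu\rangle_Q}g^\nu_{\lambda,\mu}(v)\mathfrak u_\nu$, $\mathbb K_{\alpha^\diamond}\cdot\mathbb K_{\beta^\diamond}=\mathbb K_{\alpha^\diamond+\beta^\diamond}$, $\mathbb K_{\alpha^\diamond}\cdot\mathfrak u_\lambda=v^{(\alpha,\lambda)_Q}\mathfrak u_\lambda\cdot\mathbb K_{\alpha^\diamond}$; coproduct $\Delta(\mathfrak u_\lambda)=\sum_{\mu,\nu}v^{\langle\mu,\nu\rangle_Q}f^\lambda_{\mu,\nu}(v)\,\mathfrak u_\mu\cdot\mathbb K_{\nu^\diamond}\otimes\mathfrak u_\nu$, $\Delta(\mathbb K_{\alpha^\diamond})=\mathbb K_{\alpha^\diamond}\otimes\mathbb K_{\alpha^\diamond}$; counit $\varepsilon(\mathfrak u_\lambda)=\delta_{\lambda,0}$, $\varepsilon(\mathbb K_{\alpha^\diamond})=1$. It carries the Hopf pairing $\varphi(\mathfrak u_\lambda\cdot\mathbb K_{\alpha^\diamond},\mathfrak u_\mu\cdot\mathbb K_{\beta^\diamond})=v^{(\alpha,\beta)_Q}\delta_{\lambda,\mu}a_\lambda(v)$. The algebra $D(\widetilde{\mathbf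 B}(Q))$ is the vector space $\widetilde{\mathbf B}(Q)\otimes\widetilde{\mathbf B}(Q)$ with the associative multiplication $$(a\otimes b)*(c\otimes d)=\sum\varphi(a_{(1)},d_{(2)})\,\varphi(c_{(2)},b_{(1)})\;a_{(2)}\cdot c_{(1)}\otimes b_{(2)}\cdot d_{(1)}.$$ *)

(* Defs.v *)
From HB Require Import structures.
From mathcomp Require Import all_boot all_order all_algebra all_field.
From mathcomp Require Import finmap multiset.
From mathcomp Require Import boolp classical_sets functions cardinality fsbigop.

Set Implicit Arguments.
Unset Strict Implicit.
Unset Printing Implicit Defensive.

Import Order.TTheory GRing.Theory Num.Theory.
Local Open Scope ring_scope.

Record quiver := Quiver {
  vert : finType;
  arr : finType;
  src : arr -> vert;
  tgt : arr -> vert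
}.

(* Adjacency in the simply-laced Dynkin diagrams, with vertices 0, ..., n-1.
   D_n: path 0 - ... - (n-2), with n-1 attached to n-3.
   E_n: path 0 - ... - (n-2), with n-1 attached to 2. *)
Definition path_adj (i j : nat) : bool := (j == i.+1) || (i == j.+1).
Definition branch_adj (n b i j : nat) : bool :=
  [|| [&& i < n.-1, j < n.-1 & path_adj i j],
      (i == n.-1) && (j == b) | (j == n.-1) && (i == b)]%N.

Inductive ADE_diagram : forall n : nat, rel 'I_n -> Prop :=
| ADE_A n of (1 <= n)%N : @ADE_diagram n (fun i j => path_adj i j)
| ADE_D n of (4 <= n)%N : @ADE_diagram n (fun i j => branch_adj n (n - 3) i j)
| ADE_E n of (6 <= n <= 8)%N : @ADE_diagram n (fun i j => branch_adj n 2 i j).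

Definition n_edges (Q : quiver) (i j : vert Q) : nat :=
  #|[set e : arr Q | ((src e == i) && (tgt e == j))
                     || ((src e == j) && (tgt e == i))]|.

Definition dynkin (Q : quiver) : Prop :=
  exists (n : nat) (adj : rel 'I_n) (h : vert Q -> 'I_n),
    [/\ ADE_diagram adj, bijective h
      & forall i j, n_edges i j = adj (h i) (h j) :> nat].

Record quiver_invol (Q : quiver) := QuiverInvol {
  ivert : vert Q -> vert Q;
  iarr : arr Q -> arr Q;
  ivertK : involutive ivert;
  iarrK : involutive iarr;
  isrc : forall e, src (iarr e) = ivert (src e);
  itgt : forall e, tgt (iarr e) = ivert (tgt e)
}.

Definition zvec (Q : quiver) := {ffun vert Q -> int}.

Definition euler (Q : quiver) (x y : zvec Q) : int :=
  \sum_(i : vert Q) x i * y i - \sum_(e : arr Q) x (src e) * y (tgt e).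

Definition sform (Q : quiver) (x y : zvec Q) : int := euler x y + euler y x.

Definition simple_root (Q : quiver) (i : vert Q) : zvec Q :=
  [ffun j => (j == i)%:Z].

Lemma zvecMz (Q : quiver) (x : zvec Q) (k : int) i : (x *~ k) i = x i *~ k.
Proof.
case: k => k; last rewrite !NegzE !mulrNz ffunE; first by rewrite -!pmulrn ffunMnE.
by rewrite -!pmulrn ffunMnE.
Qed.

(* The orbit of the simple roots under the Weyl group, which is generated by
   the reflections x |-> x - (x, alpha_i) alpha_i. *)
Inductive qroot (Q : quiver) : zvec Q -> Prop :=
| root_simple i : qroot (simple_root i)
| root_reflect i x : qroot x ->
    qroot (x - simple_root i *~ sform x (simple_root i)).

Definition is_posroot (Q : quiver) (x : zvec Q) : Prop :=
  qroot x /\ forall i, 0 <= x i.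

Definition posroot (Q : quiver) : choiceType :=
  {x : zvec Q | `[< is_posroot x >]}.

(* For Q a union of Dynkin quivers there are finitely many positive roots, so
   finitely supported functions posroot Q -> nat are all the functions.  As a
   sequence, l : mults Q lists each root b exactly l b times. *)
Notation mults Q := (multiset (posroot Q)).

Definition dvec (Q : quiver) (l : mults Q) : zvec Q :=
  \sum_(b <- l) val b.

(* A representation acts on row vectors: the map of e is x |-> x *m rmap X e. *)
Record rep (Q : quiver) (F : fieldType) := Rep {
  rdim : vert Q -> nat;
  rmap : forall e : arr Q, 'M[F]_(rdim (src e), rdim (tgt e))
}.

Definition rep0 (Q : quiver) (F : fieldType) : rep Q F :=
  @Rep Q F (fun=> 0%N) (fun=> 0).

Definition dsum (Q : quiver) (F : fieldType) (X Y : rep Q F) : rep Q F :=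
  @Rep Q F (fun i => rdim X i + rdim Y i)%N
    (fun e => block_mx (rmap X e) 0 0 (rmap Y e)).

Section FiniteField.
Variables (Q : quiver) (F : finFieldType).
Implicit Types X Y Z : rep Q F.

Definition homfam X Y := {dffun forall i, 'M[F]_(rdim X i, rdim Y i)}.

Definition is_hom X Y (h : homfam X Y) : bool :=
  [forall e : arr Q, rmap X e *m h (tgt e) == h (src e) *m rmap Y e].

Definition is_iso X Y (h : homfam X Y) : bool :=
  is_hom h && [forall i, row_free (h i) && row_full (h i)].

Definition isorep X Y : bool := [exists h : homfam X Y, is_iso h].

Definition zero_rep X : Prop := forall i, rdim X i = 0%N.

Definition indecomposable X : Prop :=
  ~ zero_rep X /\
  forall Y Z, isorep X (dsum Y Z) -> zero_rep Y \/ zero_rep Z.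

(* A subspace of F^d is encoded by the canonical square matrix spanning it;
   the sub- and quotient representations are written in the bases given by the
   rows of [row_base] and the columns of [col_base (cokermx _)]. *)
Definition is_subrep Y (L : homfam Y Y) : bool :=
  [forall i, <<L i>>%MS == L i] &&
  [forall e : arr Q, (L (src e) *m rmap Y e <= L (tgt e))%MS].

Definition subrep Y (L : homfam Y Y) : rep Q F :=
  @Rep Q F (fun i => \rank (L i))
    (fun e => row_base (L (src e)) *m rmap Y e
              *m pinvmx (row_base (L (tgt e)))).

Definition quorep Y (L : homfam Y Y) : rep Q F :=
  @Rep Q F (fun i => \rank (cokermx (L i)))
    (fun e => pinvmx (col_base (cokermx (L (src e)))) *m rmap Y e
              *m col_base (cokermx (L (tgt e)))).

Definition hallF X Z Y : nat :=
  #|[set L : homfam Y Y |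
      [&& is_subrep L, isorep (subrep L) Z & isorep (quorep L) X]]|.

(* (i, p) with 0 -> Z -i-> Y -p-> X -> 0 exact. *)
Definition is_ext X Z Y (s : homfam Z Y * homfam Y X) : bool :=
  [&& is_hom s.1, is_hom s.2 &
      [forall v, [&& row_free (s.1 v), row_full (s.2 v)
                   & (s.1 v == kermx (s.2 v))%MS]]].

Definition ext_equiv X Z Y : rel (homfam Z Y * homfam Y X) :=
  fun s t => [exists h : homfam Y Y,
    [&& is_iso h, [forall v, s.1 v *m h v == t.1 v]
      & [forall v, h v *m t.2 v == s.2 v]]].

(* Ext^1(X, Z)_Y: a Yoneda class with middle term isomorphic to Y is the class
   of an extension with middle term Y, and two of these are equivalent iff they
   differ by an automorphism of Y. *)
Definition extY X Z Y : {set {set homfam Z Y * homfam Y X}} :=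
  equivalence_partition (@ext_equiv X Z Y) [set s | @is_ext X Z Y s].

Definition homset X Z : {set homfam X Z} := [set h | is_hom h].

Definition autset X : {set homfam X X} := [set h | is_iso h].

Definition repM (M : posroot Q -> rep Q F) (l : mults Q) : rep Q F :=
  \big[@dsum Q F/rep0 Q F]_(b <- l) M b.

(* The third clause is the uniqueness in Gabriel's theorem: X is *the*
   indecomposable representation with dimension vector b. *)
Definition is_indec_of (b : posroot Q) X : Prop :=
  let has_dim Y := forall i, (rdim Y i)%:Z = val b i in
  [/\ has_dim X, indecomposable X
    & forall Y, has_dim Y -> indecomposable Y -> isorep Y X].

End FiniteField.

(* [Laurent p k] stands for v^(-k) p(v) in Z[v, v^-1]. *)
Record laurent := Laurent { lnum : {poly int}; lden : nat }.

Definition leval (R : fieldType) (x : R) (L : laurent) : R :=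
  (map_poly intr (lnum L)).[x] / x ^+ lden L.

(* f l m n, g l m n are f_{l,m}^n, g_{l,m}^n. *)
Record hall_data (Q : quiver) := HallData {
  indec : forall F : finFieldType, posroot Q -> rep Q F;
  indecP : forall (F : finFieldType) b, is_indec_of b (indec F b);
  hf : mults Q -> mults Q -> mults Q -> laurent;
  hg : mults Q -> mults Q -> mults Q -> laurent;
  ha : mults Q -> laurent;
  hfP : forall (F : finFieldType) l m n,
    leval (sqrtC #|F|%:R : algC) (hf l m n) =
    (hallF (repM (indec F) l) (repM (indec F) m) (repM (indec F) n))%:R;
  hgP : forall (F : finFieldType) l m n,
    leval (sqrtC #|F|%:R : algC) (hg l m n) =
    #|extY (repM (indec F) l) (repM (indec F) m) (repM (indec F) n)|%:R
    / #|homset (repM (indec F) l) (repM (indec F) m)|%:R;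
  haP : forall (F : finFieldType) l,
    leval (sqrtC #|F|%:R : algC) (ha l) = #|autset (repM (indec F) l)|%:R
}.

(* The ground field Q(v^(1/2)); the indeterminate is v^(1/2). *)
Definition K : fieldType := {fraction {poly rat}}.
Definition vsqrt : K := tofrac ('X : {poly rat}).
Definition v : K := vsqrt ^+ 2.
Definition inK (L : laurent) : K := leval v L.

(* The sum over all of T of a finitely supported family. *)
Definition fsum (T : choiceType) (V : nmodType) (F : T -> V) : V :=
  \sum_(x \in [set: T]) F x.

Notation "'\fsum_' ( x : T ) F" := (fsum (fun x : T => F))
  (at level 41, F at level 41, x name).

Definition is_basis (V : lmodType K) (T : choiceType) (b : T -> V) : Prop :=
  forall x : V, exists! c : {fsfun T -> K with 0},
    x = \sum_(t <- finsupp c) c t *: b t.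

Definition bilinear_map (U V W : lmodType K) (h : U -> V -> W) : Prop :=
  (forall u, linear (h u)) /\ (forall w, linear (fun u => h u w)).

Definition is_tensor (U V T : lmodType K) (t : U -> V -> T) : Prop :=
  bilinear_map t /\
  forall (W : lmodType K) (h : U -> V -> W), bilinear_map h ->
    (exists g : {linear T -> W}, forall x y, g (t x y) = h x y) /\
    (forall g1 g2 : {linear T -> W},
       (forall x y, g1 (t x y) = g2 (t x y)) -> g1 =1 g2).

Section Involution.
Variables (Q : quiver) (r : quiver_invol Q).

Definition rho_z (x : zvec Q) : zvec Q := [ffun i => x (ivert r i)].

Lemma euler_rho x y : euler (rho_z x) (rho_z y) = euler x y.
Proof.
rewrite /euler; congr (_ - _).
  rewrite (reindex_inj (inv_inj (ivertK r))) /=.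
  by apply: eq_bigr => i _; rewrite !ffunE ivertK.
rewrite (reindex_inj (inv_inj (iarrK r))) /=.
by apply: eq_bigr => e _; rewrite !ffunE isrc itgt !ivertK.
Qed.

Lemma rho_simple i : rho_z (simple_root i) = simple_root (ivert r i).
Proof.
by apply/ffunP => j; rewrite !ffunE (inv_eq (ivertK r)).
Qed.

Lemma rho_root x : qroot x -> qroot (rho_z x).
Proof.
elim=> [i|i {}x _ IHx]; first by rewrite rho_simple; constructor.
have -> : rho_z (x - simple_root i *~ sform x (simple_root i)) =
  rho_z x - simple_root (ivert r i)
            *~ sform (rho_z x) (simple_root (ivert r i)).
  rewrite -rho_simple /sform !euler_rho -/(sform _ _).
  by apply/ffunP => j; rewrite !(ffunE, zvecMz).
by constructor.
Qed.

Lemma rho_posroot x : `[< is_posroot x >] -> `[< is_posroot (rho_z x) >].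
Proof.
move=> /asboolP[rx px]; apply/asboolP; split; first exact: rho_root.
by move=> i; rewrite ffunE.
Qed.

Definition rho_root_act (b : posroot Q) : posroot Q :=
  exist _ (rho_z (val b)) (rho_posroot (valP b)).

(* (rho l)(b) = l (rho b), see [rho_mE]. *)
Definition rho_m (l : mults Q) : mults Q :=
  seq_mset [seq rho_root_act b | b <- l].

Lemma rho_root_actK : involutive rho_root_act.
Proof.
by move=> b; apply/val_inj/ffunP => i; rewrite /= !ffunE ivertK.
Qed.

Lemma rho_mE l b : rho_m l b = l (rho_root_act b).
Proof.
rewrite mset_seqE count_map -count_mem_mset; apply: eq_count => c /=.
by rewrite (inv_eq rho_root_actK).
Qed.

End Involution.

Record iHall_algebra (Q : quiver) (hd : hall_data Q) (r : quiver_invol Q) :=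
  IHall {
  ih_alg :> algType K;
  ih_K : zvec Q -> ih_alg;
  ih_u : mults Q -> ih_alg;
  ih_basis : is_basis (fun x : zvec Q * mults Q => ih_K x.1 * ih_u x.2);
  ih_K0 : ih_K 0 = 1;
  ih_u0 : ih_u mset0 = 1;
  ih_KK : forall a b, ih_K a * ih_K b = ih_K (a + b);
  ih_Ku : forall a l,
    ih_K a * ih_u l =
    v ^ (sform (rho_z r a) (dvec l) - sform a (dvec l)) *: (ih_u l * ih_K a);
  ih_uu : forall l m,
    ih_u l * ih_u m =
    \fsum_(t : mults Q) \fsum_(n : mults Q)
    \fsum_(c : mults Q) \fsum_(d : mults Q)
      (v ^ (euler (dvec d) (dvec t) - euler (dvec (rho_m r d)) (dvec t)
            - euler (dvec l) (dvec m) + euler (dvec n) (dvec c) *+ 2)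
       * inK (ha hd d) * inK (hf hd d n l) * inK (hf hd c (rho_m r d) m)
       * inK (hg hd n c t)) *: (ih_K (dvec d) * ih_u t)
}.

(* The vertex i^diamond of the double quiver is [inr i]. *)
Section Double.
Variable Q : quiver.

Definition dbl_end (h : arr Q -> vert Q) (e : arr Q + arr Q) : vert Q + vert Q :=
  match e with inl e => inl (h e) | inr e => inr (h e) end.

Definition dbl : quiver :=
  @Quiver (vert Q + vert Q)%type (arr Q + arr Q)%type
    (dbl_end (@src Q)) (dbl_end (@tgt Q)).

Definition sumswap (T : Type) (x : T + T) : T + T :=
  match x with inl y => inr y | inr y => inl y end.

Lemma sumswapK (T : Type) : involutive (@sumswap T).
Proof. by case. Qed.

Lemma swap_end h e : dbl_end h (sumswap e) = sumswap (dbl_end h e).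
Proof. by case: e. Qed.

Definition swap : quiver_invol dbl :=
  @QuiverInvol dbl (@sumswap (vert Q)) (@sumswap (arr Q))
    (@sumswapK (vert Q)) (@sumswapK (arr Q))
    (swap_end (@src Q)) (swap_end (@tgt Q)).

Definition zin1 (x : zvec Q) : zvec dbl :=
  [ffun i : vert Q + vert Q => if i is inl j then x j else 0 : int].
Definition zin2 (x : zvec Q) : zvec dbl :=
  [ffun i : vert Q + vert Q => if i is inr j then x j else 0 : int].

Lemma rho_zin1 x : rho_z swap (zin1 x) = zin2 x.
Proof. by apply/ffunP => -[] i; rewrite !ffunE. Qed.

Lemma euler_zin1 x y : euler (zin1 x) (zin1 y) = euler x y.
Proof.
rewrite /euler !big_sumType /=.
rewrite [X in _ + X - _]big1 ?addr0; last by move=> i _; rewrite !ffunE mul0r.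
rewrite [X in _ - (_ + X)]big1 ?addr0; last by move=> i _; rewrite !ffunE mul0r.
by congr (_ - _); apply: eq_bigr => i _; rewrite !ffunE.
Qed.

Lemma zin1_simple i : zin1 (simple_root i) = simple_root (inl i : vert dbl).
Proof. by apply/ffunP => -[] j; rewrite !ffunE. Qed.

Lemma zin1_root x : qroot x -> qroot (zin1 x).
Proof.
elim=> [i|i {}x _ IHx]; first by rewrite zin1_simple; constructor.
have -> : zin1 (x - simple_root i *~ sform x (simple_root i)) =
  zin1 x - simple_root (inl i : vert dbl)
           *~ sform (zin1 x) (simple_root (inl i : vert dbl)).
  rewrite -zin1_simple /sform !euler_zin1 -/(sform _ _).
  by apply/ffunP => -[] j; rewrite !(ffunE, zvecMz) ?mul0rz ?subr0.
by constructor.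
Qed.

Lemma zin1_posroot x : `[< is_posroot x >] -> `[< is_posroot (zin1 x) >].
Proof.
move=> /asboolP[rx px]; apply/asboolP; split; first exact: zin1_root.
by case=> i; rewrite ffunE.
Qed.

Lemma zin2_posroot x : `[< is_posroot x >] -> `[< is_posroot (zin2 x) >].
Proof. by move=> /zin1_posroot/(rho_posroot swap); rewrite rho_zin1. Qed.

Definition rin1 (b : posroot Q) : posroot dbl :=
  exist _ (zin1 (val b)) (zin1_posroot (valP b)).
Definition rin2 (b : posroot Q) : posroot dbl :=
  exist _ (zin2 (val b)) (zin2_posroot (valP b)).

(* The index of M(l) (+) M(m)^diamond. *)
Definition mpair (l m : mults Q) : mults dbl :=
  seq_mset ([seq rin1 b | b <- l] ++ [seq rin2 b | b <- m]).

End Double.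

(* [eh_K a] is K_{a^diamond}; [eh_BB] is the algebra B (x) B, in which the
   coproduct takes its values. *)
Record ext_hall (Q : quiver) (hd : hall_data Q) := ExtHall {
  eh_alg :> algType K;
  eh_u : mults Q -> eh_alg;
  eh_K : zvec Q -> eh_alg;
  eh_basis : is_basis (fun x : mults Q * zvec Q => eh_u x.1 * eh_K x.2);
  eh_u0 : eh_u mset0 = 1;
  eh_K0 : eh_K 0 = 1;
  eh_uu : forall l m,
    eh_u l * eh_u m =
    \fsum_(n : mults Q)
      (v ^ euler (dvec l) (dvec m) * inK (hg hd l m n)) *: eh_u n;
  eh_KK : forall a b, eh_K a * eh_K b = eh_K (a + b);
  eh_Ku : forall a l, eh_K a * eh_u l = v ^ sform a (dvec l) *: (eh_u l * eh_K a);
  eh_BB : algType K;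
  eh_tens : eh_alg -> eh_alg -> eh_BB;
  eh_tensP : is_tensor eh_tens;
  eh_tensM : forall a b c d,
    eh_tens a b * eh_tens c d = eh_tens (a * c) (b * d);
  eh_Delta : {lrmorphism eh_alg -> eh_BB};
  eh_Delta_u : forall l,
    eh_Delta (eh_u l) =
    \fsum_(m : mults Q) \fsum_(n : mults Q)
      (v ^ euler (dvec m) (dvec n) * inK (hf hd m n l))
      *: eh_tens (eh_u m * eh_K (dvec n)) (eh_u n);
  eh_Delta_K : forall a, eh_Delta (eh_K a) = eh_tens (eh_K a) (eh_K a);
  eh_eps : {lrmorphism eh_alg -> K^o};
  eh_eps_u : forall l, eh_eps (eh_u l) = (l == mset0)%:R;
  eh_eps_K : forall a, eh_eps (eh_K a) = 1;
  eh_phi : eh_alg -> eh_alg -> K^o;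
  eh_phi_bilinear : bilinear_map eh_phi;
  eh_phiE : forall l a m b,
    eh_phi (eh_u l * eh_K a) (eh_u m * eh_K b) =
    v ^ sform a b * (l == m)%:R * inK (ha hd l)
}.

(* The Sweedler sums are expanded along arbitrary expressions of the coproducts
   as finite sums of pure tensors, given as sequences of pairs. *)
Record hall_double (Q : quiver) (hd : hall_data Q) (B : ext_hall hd) := HallDouble {
  dd_alg :> algType K;
  dd_tens : B -> B -> dd_alg;
  dd_tensP : is_tensor dd_tens;
  dd_mul : forall (a b c d : B) (sa sb sc sd : seq (B * B)),
    let delta x s := eh_Delta B x = \sum_(p <- s) eh_tens p.1 p.2 in
    delta a sa -> delta b sb -> delta c sc -> delta d sd ->
    dd_tens a b * dd_tens c d =
    \sum_(x <- sa) \sum_(y <- sb) \sum_(z <- sc) \sum_(w <- sd)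
      (eh_phi x.1 w.2 * eh_phi z.2 y.1) *: dd_tens (x.2 * z.1) (y.2 * w.1)
}.

(* Main.v *)
From HB Require Import structures.
Require Import Defs.
From mathcomp Require Import all_boot all_order all_algebra all_field.
From mathcomp Require Import finmap multiset zify ring.
From mathcomp Require Import boolp classical_sets fsbigop.

(** The isomorphism holds because the two multiplications agree term by term.
    In terms of the basis elements K_x * u_lambda, with x = (a, b) and
    lambda = (l, m) split along the two copies of Q, the map reads

      K_(a,b) * u_(l,m)  |->  v^(a,b) (K_b u_l) (x) (K_a u_m).

    Expanding the product of two such elements in the iHall algebra gives a sum
    over delta, nu, gamma, theta; each index splits along the two copies of Q,
    and since the involution swaps the copies, the Hall polynomials occurring are
      f^l1_(d1,n1) f^l2_(d2,n2) f^m1_(c1,d2) f^m2_(c2,d1) g^t1_(n1,c1) g^t2_(n2,c2).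
    On the other side, the coproduct of u_l1 and of the other three factors
    produces the same four polynomials f, the pairing phi identifies the indices
    d1 and d2 of the two middle pieces and contributes a_d1 a_d2, and the two
    remaining products in the extended Hall algebra contribute the two
    polynomials g.  The powers of v agree because all terms with inhomogeneous
    dimension vectors vanish ([term_match]).

    The comparison requires that the Hall polynomials of the double quiver be
    products of those of Q ([hf_mpair], [hg_mpair], [ha_mpair]).  A
    representation of the double quiver is a pair of representations of Q, and
    all the numbers concerned are multiplicative for such pairs and invariant
    under isomorphism.  For the two Hall numbers, this becomes transparent once
    both are written as the number of values of a map on the set of short exact
    sequences ([hallFE], [extYE]).  The indecomposable of the double quiver at a
    root of one copy restricts to the indecomposable of Q on that copy and to zero
    on the other ([res_rin1], [res_rin2]), and the identity passes from numbers to
    polynomials since a Laurent polynomial is determined by its values at the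
    square roots of the primes ([inK_ext]).

    The map is defined on a basis; its inverse comes from the universal property
    of the tensor square and the basis of the extended Hall algebra.  It
    preserves the unit because it is multiplicative and surjective. *)

Set Implicit Arguments.
Unset Strict Implicit.
Unset Printing Implicit Defensive.

Import Order.TTheory GRing.Theory Num.Theory.
Local Open Scope ring_scope.

(** * Hall numbers of the double quiver *)

(** ** Isomorphisms of representations *)

Section Reps.
Variables (Q : quiver) (F : finFieldType).
Implicit Types X Y Z : rep Q F.

Definition homf X Y := forall i, 'M[F]_(rdim X i, rdim Y i).

Definition intertwines X Y (h : homf X Y) : Prop :=
  forall e, rmap X e *m h (tgt e) = h (src e) *m rmap Y e.

(** An inverse family, rather than a condition on ranks, makes isomorphisms easy to
    invert, compose and transport along. *)
Definition repiso X Y : Prop :=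
  exists (h : homf X Y) (k : homf Y X),
    [/\ intertwines h, forall i, h i *m k i = 1%:M & forall i, k i *m h i = 1%:M].

Definition tofam X Y (h : homf X Y) : homfam X Y := [ffun i => h i].

Lemma tofamE X Y (h : homf X Y) i : tofam h i = h i.
Proof. by rewrite ffunE. Qed.

Lemma homfamP X Y (h k : homfam X Y) : (forall i, h i = k i) -> h = k.
Proof. by move=> hk; apply/ffunP. Qed.

Lemma is_homP X Y (h : homfam X Y) : reflect (intertwines h) (is_hom h).
Proof.
apply: (iffP forallP) => H e; first exact/eqP/H.
by apply/eqP/H.
Qed.

Lemma intertwines_inv X Y (h : homf X Y) (k : homf Y X) :
  intertwines h -> (forall i, h i *m k i = 1%:M) -> (forall i, k i *m h i = 1%:M) ->
  intertwines k.
Proof.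
move=> Hh hk kh e.
by rewrite -[LHS]mul1mx -(kh (src e)) -mulmxA (mulmxA _ (rmap _ _)) -Hh -!mulmxA hk mulmx1.
Qed.

Lemma intertwines_comp X Y Z (h : homf X Y) (k : homf Y Z) :
  intertwines h -> intertwines k -> intertwines (fun i => h i *m k i).
Proof.
move=> Hh Hk e /=; have Hhe := Hh e; have Hke := Hk e.
by rewrite mulmxA Hhe -[LHS]mulmxA Hke mulmxA.
Qed.

Lemma right_inv_free m n (A : 'M[F]_(m, n)) B :
  A *m B = 1%:M -> row_free A.
Proof. by move=> AB; apply/row_freeP; exists B. Qed.

Lemma left_inv_full m n (A : 'M[F]_(m, n)) B :
  B *m A = 1%:M -> row_full A.
Proof. by move=> AB; apply/row_fullP; exists B. Qed.

Lemma is_isoP X Y (h : homfam X Y) :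
  reflect (intertwines h /\ exists k : homf Y X,
     (forall i, h i *m k i = 1%:M) /\ (forall i, k i *m h i = 1%:M)) (is_iso h).
Proof.
apply: (iffP andP) => [[/is_homP Hh /forallP H]|[Hh [k [hk kh]]]].
  split=> //; exists (fun i => pinvmx (h i)).
  by split=> i; have /andP[hf hF] := H i; rewrite ?mulmxVp ?mulVpmx.
split; first exact/is_homP.
apply/forallP => i; apply/andP; split.
  exact: right_inv_free (hk i).
exact: left_inv_full (kh i).
Qed.

Lemma isorepP X Y : reflect (repiso X Y) (isorep X Y).
Proof.
apply: (iffP existsP) => [[h /is_isoP[Hh [k [hk kh]]]]|[h [k [Hh hk kh]]]].
  by exists h, k.
exists (tofam h); apply/is_isoP; split.
  by move=> e; rewrite !tofamE.
by exists k; split=> i; rewrite !tofamE.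
Qed.

Lemma repiso_refl X : repiso X X.
Proof.
exists (fun i => 1%:M), (fun i => 1%:M).
by split=> [e|i|i]; rewrite ?mul1mx ?mulmx1.
Qed.

Lemma repiso_sym X Y : repiso X Y -> repiso Y X.
Proof.
by move=> [h [k [Hh hk kh]]]; exists k, h; split=> //; apply: intertwines_inv Hh hk kh.
Qed.

Lemma repiso_trans Y X Z : repiso X Y -> repiso Y Z -> repiso X Z.
Proof.
move=> [h [k [Hh hk kh]]] [h' [k' [Hh' hk' kh']]].
exists (fun i => h i *m h' i), (fun i => k' i *m k i); split.
- exact: intertwines_comp.
- by move=> i; rewrite mulmxA -(mulmxA (h i)) hk' mulmx1.
- by move=> i; rewrite mulmxA -(mulmxA (k' i)) kh mulmx1.
Qed.

(** ** Short exact sequences *)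

(** A subrepresentation is determined up to isomorphism by its image: two
    monomorphisms with the same image have isomorphic sources. *)
Lemma mono_iso Y Z Z' (i : homf Z Y) (j : homf Z' Y) :
  intertwines i -> intertwines j -> (forall v, row_free (i v)) -> (forall v, row_free (j v)) ->
  (forall v, (i v == j v)%MS) -> repiso Z Z'.
Proof.
move=> Hi Hj fi fj ij.
have ij1 v : (i v <= j v)%MS by have /andP[] := ij v.
have ij2 v : (j v <= i v)%MS by have /andP[] := ij v.
exists (fun v => i v *m pinvmx (j v)), (fun v => j v *m pinvmx (i v)); split.
- move=> e; apply: (row_free_inj (fj (tgt e))) => /=.
  rewrite -[LHS]mulmxA mulmxKpV // Hi -[RHS]mulmxA Hj [RHS]mulmxA.
  by rewrite mulmxKpV.
- move=> v; apply: (row_free_inj (fi v)) => /=.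
  by rewrite mul1mx -[LHS]mulmxA mulmxKpV // mulmxKpV.
- move=> v; apply: (row_free_inj (fj v)) => /=.
  by rewrite mul1mx -[LHS]mulmxA mulmxKpV // mulmxKpV.
Qed.

Lemma pinv_full_ker m n (p : 'M[F]_(m, n)) k (q : 'M[F]_(m, k)) :
  row_full p -> (kermx p <= kermx q)%MS -> p *m (pinvmx p *m q) = q.
Proof.
move=> fp pq; apply/eqP; rewrite -subr_eq0 mulmxA -{2}[q]mul1mx -mulmxBl.
apply/eqP/sub_kermxP/(fun H => submx_trans H pq).
by apply/sub_kermxP; rewrite mulmxBl -mulmxA mulVpmx // mulmx1 mul1mx subrr.
Qed.

(** Dually, a quotient is determined up to isomorphism by the kernel. *)
Lemma epi_iso Y X X' (p : homf Y X) (q : homf Y X') :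
  intertwines p -> intertwines q -> (forall v, row_full (p v)) -> (forall v, row_full (q v)) ->
  (forall v, (kermx (p v) == kermx (q v))%MS) -> repiso X X'.
Proof.
move=> Hp Hq fp fq pq.
have pq1 v : (kermx (p v) <= kermx (q v))%MS by have /andP[] := pq v.
have pq2 v : (kermx (q v) <= kermx (p v))%MS by have /andP[] := pq v.
exists (fun v => pinvmx (p v) *m q v), (fun v => pinvmx (q v) *m p v); split.
- move=> e; apply: (row_full_inj (fp (src e))) => /=.
  rewrite [LHS]mulmxA -Hp -[LHS]mulmxA pinv_full_ker // Hq [RHS]mulmxA.
  by rewrite pinv_full_ker.
- move=> v; apply: (row_full_inj (fp v)) => /=.
  by rewrite mulmx1 mulmxA pinv_full_ker // pinv_full_ker.
- move=> v; apply: (row_full_inj (fq v)) => /=.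
  by rewrite mulmx1 mulmxA pinv_full_ker // pinv_full_ker.
Qed.

Lemma cokermx_col_base n (L : 'M[F]_n) m (A : 'M_(m, n)) :
  (A *m col_base (cokermx L) == 0) = (A <= L)%MS.
Proof.
rewrite submxE -[in RHS](mulmx_base (cokermx L)) mulmxA.
by rewrite (mulmx_free_eq0 _ (row_base_free _)).
Qed.

Lemma subrep_row_base Y (L : homfam Y Y) : is_subrep L ->
  intertwines (X := subrep L) (Y := Y) (fun v => row_base (L v)).
Proof.
move=> /andP[_ /forallP HL] e; rewrite /= mulmxKpV //.
by rewrite eq_row_base (eqmxMr _ (eq_row_base _)) HL.
Qed.

Lemma quorep_col_base Y (L : homfam Y Y) : is_subrep L ->
  intertwines (X := Y) (Y := quorep L) (fun v => col_base (cokermx (L v))).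
Proof.
move=> /andP[_ /forallP HL] e; rewrite /= -[X in _ = _ *m X]mulmxA pinv_full_ker //.
  exact: col_base_full.
apply/sub_kermxP/eqP; rewrite mulmxA cokermx_col_base.
apply: submx_trans (HL e); apply: submxMr.
by rewrite -cokermx_col_base mulmx_ker.
Qed.

Definition ses X Z Y : {set homfam Z Y * homfam Y X} := [set s | is_ext s].

Definition ses_image X Z Y (s : homfam Z Y * homfam Y X) : homfam Y Y :=
  [ffun v => <<s.1 v>>%MS].

Lemma is_extP X Z Y (s : homfam Z Y * homfam Y X) :
  reflect [/\ intertwines s.1, intertwines s.2, forall v, row_free (s.1 v),
              forall v, row_full (s.2 v) & forall v, (s.1 v == kermx (s.2 v))%MS]
          (is_ext s).
Proof.
apply: (iffP and3P) => [[/is_homP H1 /is_homP H2 /forallP H]|[H1 H2 H3 H4 H5]].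
  by split=> // v; have /and3P[] := H v.
by split; [exact/is_homP|exact/is_homP|apply/forallP=> v; apply/and3P; split].
Qed.

(** A subrepresentation with prescribed isomorphism types of itself and of the
    quotient is the same as the image of a short exact sequence between fixed
    representations, which no longer involves the bases chosen to write down sub-
    and quotient representations. *)
Lemma hallFE X Z Y : hallF X Z Y = #|@ses_image X Z Y @: ses X Z Y|.
Proof.
apply: eq_card => L; rewrite inE; apply/idP/imsetP.
  case/and3P=> sL /isorepP/repiso_sym[i [i' [Hi ii' i'i]]] /isorepP[p [p' [Hp pp' p'p]]].
  pose s := (tofam (fun v => i v *m row_base (L v)) : homfam Z Y,
             tofam (fun v => col_base (cokermx (L v)) *m p v) : homfam Y X).
  have s1 v : (s.1 v :=: L v)%MS.
    rewrite tofamE; apply: (eqmx_trans _ (eq_row_base _)).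
    by apply: eqmxMfull; apply: left_inv_full (i'i v).
  exists s; last first.
    apply: homfamP => v; rewrite ffunE (eq_genmx (s1 v)).
    by case/andP: sL => /forallP/(_ v)/eqP.
  rewrite inE; apply/is_extP; split => /=.
  - by move=> e; rewrite !tofamE; apply: intertwines_comp Hi (subrep_row_base sL) e.
  - by move=> e; rewrite !tofamE; apply: intertwines_comp (quorep_col_base sL) Hp e.
  - move=> v; rewrite tofamE /row_free (mxrankMfree _ (row_base_free _)).
    exact: right_inv_free (ii' v).
  - move=> v; rewrite tofamE; apply/row_fullP.
    exists (p' v *m pinvmx (col_base (cokermx (L v)))).
    by rewrite mulmxA -(mulmxA (p' v)) mulVpmx ?col_base_full // mulmx1 p'p.
  - move=> v; apply/eqmxP/(eqmx_trans (s1 v)); rewrite [X in kermx X]tofamE.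
    have fp := right_inv_free (pp' v).
    apply/eqmxP/andP; split.
      apply/sub_kermxP/eqP; rewrite mulmxA (mulmx_free_eq0 _ fp).
      by rewrite cokermx_col_base.
    rewrite -cokermx_col_base -(mulmx_free_eq0 _ fp) -mulmxA.
    exact/eqP/mulmx_ker.
case=> s; rewrite inE => /is_extP[H1 H2 f1 f2 s12] ->{L}.
set L := ses_image s.
have Ls v : (L v :=: s.1 v)%MS by rewrite ffunE; exact: genmxE.
have sL : is_subrep L.
  apply/andP; split; apply/forallP => v; first by rewrite ffunE genmx_id.
  by rewrite (eqmxMr _ (Ls _)) (Ls _) -H1 submxMl.
rewrite sL /=; apply/andP; split; apply/isorepP.
  apply: mono_iso (subrep_row_base sL) H1 _ f1 _ => v; first exact: row_base_free.
  exact/eqmxP/(eqmx_trans (eq_row_base _)).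
apply: epi_iso (quorep_col_base sL) H2 _ f2 _ => v; first exact: col_base_full.
apply/eqmxP/(eqmx_trans _ (eqmxP (s12 v)))/(eqmx_trans _ (Ls v)).
apply/eqmxP/andP; split; first by rewrite -cokermx_col_base mulmx_ker.
by apply/sub_kermxP/eqP; rewrite cokermx_col_base.
Qed.

Lemma ext_equivP X Z Y (s t : homfam Z Y * homfam Y X) :
  reflect (exists (h k : homf Y Y),
     [/\ intertwines h, forall v, h v *m k v = 1%:M, forall v, k v *m h v = 1%:M,
         forall v, s.1 v *m h v = t.1 v & forall v, h v *m t.2 v = s.2 v])
  (ext_equiv s t).
Proof.
apply: (iffP existsP) => [[h /and3P[/is_isoP[Hh [k [hk kh]]] /forallP st1 /forallP st2]]|].
  by exists h, k; split=> // v; [exact/eqP/st1|exact/eqP/st2].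
move=> [h [k [Hh hk kh st1 st2]]]; exists (tofam h); apply/and3P; split.
- apply/is_isoP; split; first by move=> e; rewrite !tofamE.
  by exists k; split=> v; rewrite tofamE.
- by apply/forallP => v; rewrite tofamE st1.
- by apply/forallP => v; rewrite tofamE st2.
Qed.

Lemma ext_equiv_refl X Z Y : reflexive (@ext_equiv Q F X Z Y).
Proof.
move=> s; apply/ext_equivP; exists (fun=> 1%:M), (fun=> 1%:M).
by split=> v; rewrite ?mulmx1 ?mul1mx.
Qed.

Lemma ext_equiv_sym X Z Y (s t : homfam Z Y * homfam Y X) :
  ext_equiv s t -> ext_equiv t s.
Proof.
move=> /ext_equivP[h [k [Hh hk kh st1 st2]]]; apply/ext_equivP; exists k, h.
split=> // [|v|v]; first exact: intertwines_inv Hh hk kh.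
  by rewrite -st1 -mulmxA hk mulmx1.
by rewrite -st2 mulmxA kh mul1mx.
Qed.

Lemma ext_equiv_trans X Z Y (s t u : homfam Z Y * homfam Y X) :
  ext_equiv s t -> ext_equiv t u -> ext_equiv s u.
Proof.
move=> /ext_equivP[h [k [Hh hk kh st1 st2]]] /ext_equivP[h' [k' [Hh' hk' kh' tu1 tu2]]].
apply/ext_equivP; exists (fun v => h v *m h' v), (fun v => k' v *m k v); split.
- exact: intertwines_comp.
- by move=> v; rewrite mulmxA -(mulmxA (h v)) hk' mulmx1.
- by move=> v; rewrite mulmxA -(mulmxA (k' v)) kh mulmx1.
- by move=> v; rewrite mulmxA st1.
- by move=> v; rewrite -mulmxA tu2.
Qed.

Definition ses_class X Z Y (s : homfam Z Y * homfam Y X) :=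
  [set t in ses X Z Y | ext_equiv s t].

Lemma extYE X Z Y : extY X Z Y = @ses_class X Z Y @: ses X Z Y.
Proof. by []. Qed.

Lemma ses_classP X Z Y (s t : homfam Z Y * homfam Y X) :
  t \in ses X Z Y ->
  ses_class s = ses_class t <-> ext_equiv s t.
Proof.
rewrite inE => tD; split=> [/setP/(_ t)|st].
  by rewrite !inE tD ext_equiv_refl.
apply/setP => u; rewrite !inE; case: is_ext => //=; apply/idP/idP.
  exact/ext_equiv_trans/ext_equiv_sym.
exact: ext_equiv_trans.
Qed.

End Reps.

(** ** Invariance under isomorphism *)

(** Both Hall numbers count values of maps, that is, classes.  Classes on the two
    sides are compared through [psi] on representatives alone: it is enough that
    [psi] never merges two classes. *)
Lemma card_imset_le (T T' U U' : finType) (f : T -> U) (f' : T' -> U')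
    (D : {set T}) (D' : {set T'}) (psi : T -> T') :
  (forall x, x \in D -> psi x \in D') ->
  (forall x y, x \in D -> y \in D -> f' (psi x) = f' (psi y) -> f x = f y) ->
  (#|f @: D| <= #|f' @: D'|)%N.
Proof.
move=> psiD psiI.
pose g u := omap (fun x => f' (psi x)) [pick x in D | f x == u].
have gE u : u \in f @: D -> exists x, [/\ x \in D, f x = u & g u = Some (f' (psi x))].
  rewrite /g => /imsetP[x0 x0D ->].
  case: pickP => [x /andP[xD /eqP fx]|/(_ x0)]; last by rewrite /= x0D eqxx.
  by exists x.
rewrite -(card_in_imset (f := g)) => [|u w /gE[x [xD <- ->]] /gE[y [yD <- ->]] []].
  rewrite -[leqRHS](card_imset _ (@Some_inj _)); apply/subset_leq_card/fintype.subsetP => o.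
  by case/imsetP=> u /gE[x [xD _ ->]] ->; apply/imset_f/imset_f/psiD.
exact: psiI.
Qed.

Section Transport.
Variables (Q : quiver) (F : finFieldType) (X X' Z Z' Y Y' : rep Q F).
Variables (hX : homf X X') (kX : homf X' X) (hZ : homf Z Z') (kZ : homf Z' Z).
Variables (hY : homf Y Y') (kY : homf Y' Y).
Hypotheses (HX : intertwines hX) (hkX : forall v, hX v *m kX v = 1%:M)
  (khX : forall v, kX v *m hX v = 1%:M).
Hypotheses (HZ : intertwines hZ) (hkZ : forall v, hZ v *m kZ v = 1%:M)
  (khZ : forall v, kZ v *m hZ v = 1%:M).
Hypotheses (HY : intertwines hY) (hkY : forall v, hY v *m kY v = 1%:M)
  (khY : forall v, kY v *m hY v = 1%:M).

Definition transport (s : homfam Z Y * homfam Y X) : homfam Z' Y' * homfam Y' X' :=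
  (tofam (fun v => kZ v *m s.1 v *m hY v), tofam (fun v => kY v *m s.2 v *m hX v)).

Lemma transport_ses s : s \in ses X Z Y -> transport s \in ses X' Z' Y'.
Proof.
rewrite !inE => /is_extP[H1 H2 f1 f2 s12].
have HkZ := intertwines_inv HZ hkZ khZ; have HkY := intertwines_inv HY hkY khY.
have fullZ v : row_full (kZ v) := left_inv_full (hkZ v).
have freeZ v : row_free (kZ v) := right_inv_free (khZ v).
have freeX v : row_free (hX v) := right_inv_free (hkX v).
have freeY v : row_free (hY v) := right_inv_free (hkY v).
apply/is_extP; split=> /=.
- by move=> e; rewrite !tofamE; apply: intertwines_comp (intertwines_comp HkZ H1) HY e.
- by move=> e; rewrite !tofamE; apply: intertwines_comp (intertwines_comp HkY H2) HX e.
- move=> v; rewrite tofamE /row_free !mxrankMfree //; exact: freeZ.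
- move=> v; have /row_fullP[B BE] := f2 v; rewrite tofamE; apply/row_fullP.
  exists (kX v *m B *m hY v); rewrite !mulmxA -(mulmxA _ (hY v)) hkY mulmx1.
  by rewrite -(mulmxA _ B) BE mulmx1 khX.
move=> v; rewrite [X in kermx X]tofamE [X in (X == _)%MS]tofamE -!mulmxA.
apply/eqmxP/(eqmx_trans (eqmxMfull _ (fullZ v)))/eqmxP/andP; split.
  apply/sub_kermxP; rewrite !mulmxA -(mulmxA _ (hY v)) hkY mulmx1.
  have /andP[/sub_kermxP -> _] := s12 v; exact: mul0mx.
move: (kermx _) (mulmx_ker (kY v *m (s.2 v *m hX v))) => N.
rewrite !mulmxA => N0; have -> : N = N *m kY v *m hY v by rewrite -mulmxA khY mulmx1.
rewrite submxMr //; have /andP[_ H] := s12 v; apply: submx_trans H.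
by apply/sub_kermxP/eqP; rewrite -(mulmx_free_eq0 _ (freeX v)) N0.
Qed.

Lemma transport_image s t :
  ses_image (transport s) = ses_image (transport t) -> ses_image s = ses_image t.
Proof.
move=> /ffunP st; apply: homfamP => v; have := st v; rewrite !ffunE => /eqP.
have fullZ : row_full (kZ v) := left_inv_full (hkZ v).
have freeY : row_free (hY v) := right_inv_free (hkY v).
rewrite -!mulmxA !(eq_genmx (eqmxMfull _ fullZ)) => /eqP/genmxP/eqmxP.
by move=> /(eqmxMfree freeY)/eqmxP/genmxP.
Qed.

Lemma transport_class s t : s \in ses X Z Y -> t \in ses X Z Y ->
  ses_class (transport s) = ses_class (transport t) -> ses_class s = ses_class t.
Proof.
move=> sD tD /(ses_classP _ (transport_ses tD))/ext_equivP[h [k [Hh hk kh]]].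
move=> st1 st2; apply/(ses_classP _ tD)/ext_equivP.
have HkY := intertwines_inv HY hkY khY.
exists (fun v => hY v *m h v *m kY v), (fun v => hY v *m k v *m kY v); split.
- exact: intertwines_comp (intertwines_comp HY Hh) HkY.
- move=> v; rewrite !mulmxA -(mulmxA _ (kY v)) khY mulmx1.
  by rewrite -(mulmxA _ (h v)) hk mulmx1 hkY.
- move=> v; rewrite !mulmxA -(mulmxA _ (kY v)) khY mulmx1.
  by rewrite -(mulmxA _ (k v)) kh mulmx1 hkY.
- move=> v; have := st1 v; rewrite !tofamE => /(congr1 (fun A => hZ v *m A *m kY v)).
  by rewrite !mulmxA hkZ !mul1mx -(mulmxA (t.1 v)) hkY mulmx1.
- move=> v; have := st2 v; rewrite !tofamE => /(congr1 (fun A => hY v *m A *m kX v)).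
  by rewrite !mulmxA hkY !mul1mx -!(mulmxA _ (hX v)) hkX !mulmx1.
Qed.

End Transport.

Section Invariance.
Variables (Q : quiver) (F : finFieldType).
Implicit Types X Y Z : rep Q F.

Lemma hallF_le X X' Z Z' Y Y' : repiso X X' -> repiso Z Z' -> repiso Y Y' ->
  (hallF X Z Y <= hallF X' Z' Y')%N.
Proof.
move=> [hX [kX [HX hkX khX]]] [hZ [kZ [HZ hkZ khZ]]] [hY [kY [HY hkY khY]]].
rewrite !hallFE; apply: (card_imset_le (psi := transport hX kZ hY kY)).
  by move=> s; apply: (transport_ses (hZ := hZ) (kX := kX)).
move=> s t _ _; exact: (transport_image (hZ := hZ)).
Qed.

Lemma hallF_iso X X' Z Z' Y Y' : repiso X X' -> repiso Z Z' -> repiso Y Y' ->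
  hallF X Z Y = hallF X' Z' Y'.
Proof.
move=> XX ZZ YY; apply/eqP; rewrite eqn_leq !hallF_le //; exact: repiso_sym.
Qed.

Lemma extY_le X X' Z Z' Y Y' : repiso X X' -> repiso Z Z' -> repiso Y Y' ->
  (#|extY X Z Y| <= #|extY X' Z' Y'|)%N.
Proof.
move=> [hX [kX [HX hkX khX]]] [hZ [kZ [HZ hkZ khZ]]] [hY [kY [HY hkY khY]]].
rewrite !extYE; apply: (card_imset_le (psi := transport hX kZ hY kY)).
  by move=> s; apply: (transport_ses (hZ := hZ) (kX := kX)).
move=> s t; exact: (transport_class (hZ := hZ) (kX := kX)).
Qed.

Lemma extY_iso X X' Z Z' Y Y' : repiso X X' -> repiso Z Z' -> repiso Y Y' ->
  #|extY X Z Y| = #|extY X' Z' Y'|.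
Proof.
move=> XX ZZ YY; apply/eqP; rewrite eqn_leq !extY_le //; exact: repiso_sym.
Qed.

Lemma homset_le X X' Z Z' : repiso X X' -> repiso Z Z' ->
  (#|homset X Z| <= #|homset X' Z'|)%N.
Proof.
move=> [hX [kX [HX hkX khX]]] [hZ [kZ [HZ hkZ khZ]]].
pose psi (h : homfam X Z) := tofam (fun v => kX v *m h v *m hZ v) : homfam X' Z'.
rewrite -[X in (X <= _)%N](card_imset _ (@inj_id _)).
rewrite -[X in (_ <= X)%N](card_imset _ (@inj_id _)).
apply: (card_imset_le (psi := psi)) => [h|g h _ _ /ffunP gh].
  rewrite !inE => /is_homP Hh; apply/is_homP => e; rewrite !tofamE.
  by apply: intertwines_comp (intertwines_comp (intertwines_inv HX hkX khX) Hh) HZ e.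
apply: homfamP => v; have := gh v; rewrite !ffunE.
move=> /(congr1 (fun A => hX v *m A *m kZ v)).
by rewrite !mulmxA hkX !mul1mx -!(mulmxA _ (hZ v)) hkZ !mulmx1.
Qed.

Lemma homset_iso X X' Z Z' : repiso X X' -> repiso Z Z' ->
  #|homset X Z| = #|homset X' Z'|.
Proof.
move=> XX ZZ; apply/eqP; rewrite eqn_leq !homset_le //; exact: repiso_sym.
Qed.

Lemma autset_le X X' : repiso X X' -> (#|autset X| <= #|autset X'|)%N.
Proof.
move=> [hX [kX [HX hkX khX]]].
pose psi (h : homfam X X) := tofam (fun v => kX v *m h v *m hX v) : homfam X' X'.
rewrite -[X in (X <= _)%N](card_imset _ (@inj_id _)).
rewrite -[X in (_ <= X)%N](card_imset _ (@inj_id _)).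
apply: (card_imset_le (psi := psi)) => [h|g h _ _ /ffunP gh].
  rewrite !inE => /is_isoP[Hh [k [hk kh]]]; apply/is_isoP; split.
    move=> e; rewrite !tofamE.
    by apply: intertwines_comp (intertwines_comp (intertwines_inv HX hkX khX) Hh) HX e.
  exists (fun v => kX v *m k v *m hX v); split=> v; rewrite tofamE !mulmxA.
    by rewrite -(mulmxA _ (hX v)) hkX mulmx1 -(mulmxA _ (h v)) hk mulmx1 khX.
  by rewrite -(mulmxA _ (hX v)) hkX mulmx1 -(mulmxA _ (k v)) kh mulmx1 khX.
apply: homfamP => v; have := gh v; rewrite !ffunE.
move=> /(congr1 (fun A => hX v *m A *m kX v)).
by rewrite !mulmxA hkX !mul1mx -!(mulmxA _ (hX v)) hkX !mulmx1.
Qed.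

Lemma autset_iso X X' : repiso X X' -> #|autset X| = #|autset X'|.
Proof.
move=> XX; apply/eqP; rewrite eqn_leq !autset_le //; exact: repiso_sym.
Qed.

End Invariance.

(** ** Restriction to the two halves of the double quiver *)

(** For a set that is a product compatibly with the classes on it, the classes of
    pairs are the pairs of classes. *)
Lemma card_imset_prod (T T1 T2 U U1 U2 : finType) (f : T -> U) (f1 : T1 -> U1)
    (f2 : T2 -> U2) (D : {set T}) (D1 : {set T1}) (D2 : {set T2})
    (p1 : T -> T1) (p2 : T -> T2) (q : T1 -> T2 -> T) :
  (forall x1 x2, p1 (q x1 x2) = x1) -> (forall x1 x2, p2 (q x1 x2) = x2) ->
  (forall x, (x \in D) = (p1 x \in D1) && (p2 x \in D2)) ->
  (forall x y, x \in D -> y \in D ->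
     f x = f y <-> f1 (p1 x) = f1 (p1 y) /\ f2 (p2 x) = f2 (p2 y)) ->
  #|f @: D| = (#|f1 @: D1| * #|f2 @: D2|)%N.
Proof.
move=> q1 q2 DE fE; pose f12 u := (f1 u.1, f2 u.2).
have -> : (#|f1 @: D1| * #|f2 @: D2| = #|f12 @: finset.setX D1 D2|)%N.
  rewrite -cardsX; apply: eq_card => -[u1 u2]; rewrite !inE /=.
  apply/andP/imsetP => [[/imsetP[x1 xD1 ->] /imsetP[x2 xD2 ->]]|[[x1 x2]]].
    by exists (x1, x2); rewrite ?inE ?xD1.
  by rewrite !inE => /andP[/= xD1 xD2] [-> ->]; split; apply: imset_f.
apply/eqP; rewrite eqn_leq; apply/andP; split.
  apply: (card_imset_le (psi := fun x => (p1 x, p2 x))) => [x|x y xD yD [/= xy1 xy2]].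
    by rewrite inE DE.
  exact/fE.
apply: (card_imset_le (psi := fun u => q u.1 u.2)) => [u|u w].
  by rewrite inE DE q1 q2.
rewrite !inE => uD wD /fE; rewrite !DE !q1 !q2 => /(_ uD wD)[uw1 uw2].
by rewrite /f12 uw1 uw2.
Qed.

Section Double.
Variables (Q : quiver) (F : finFieldType).
Implicit Types X Y Z : rep (dbl Q) F.

Definition res1 X : rep Q F :=
  @Rep Q F (fun i => rdim X (inl i : vert (dbl Q)))
           (fun e => rmap X (inl e : arr (dbl Q))).

Definition res2 X : rep Q F :=
  @Rep Q F (fun i => rdim X (inr i : vert (dbl Q)))
           (fun e => rmap X (inr e : arr (dbl Q))).

Definition fam1 X Y (h : homfam X Y) : homfam (res1 X) (res1 Y) :=
  tofam (X := res1 X) (Y := res1 Y) (fun i => h (inl i : vert (dbl Q))).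

Definition fam2 X Y (h : homfam X Y) : homfam (res2 X) (res2 Y) :=
  tofam (X := res2 X) (Y := res2 Y) (fun i => h (inr i : vert (dbl Q))).

Lemma fam1E X Y (h : homfam X Y) i : fam1 h i = h (inl i : vert (dbl Q)).
Proof. exact: tofamE. Qed.

Lemma fam2E X Y (h : homfam X Y) i : fam2 h i = h (inr i : vert (dbl Q)).
Proof. exact: tofamE. Qed.

Definition glue X Y (h1 : homf (res1 X) (res1 Y)) (h2 : homf (res2 X) (res2 Y)) :
    homf X Y :=
  fun i : vert (dbl Q) => match i with inl j => h1 j | inr j => h2 j end.

Definition glue_fam X Y (h1 : homfam (res1 X) (res1 Y)) (h2 : homfam (res2 X) (res2 Y)) :
  homfam X Y := tofam (glue h1 h2).

Lemma glue_fam1 X Y (h1 : homfam (res1 X) (res1 Y)) h2 : fam1 (glue_fam h1 h2) = h1.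
Proof. by apply: homfamP => v; rewrite !tofamE. Qed.

Lemma glue_fam2 X Y h1 (h2 : homfam (res2 X) (res2 Y)) : fam2 (glue_fam h1 h2) = h2.
Proof. by apply: homfamP => v; rewrite !tofamE. Qed.

Lemma fam_eq X Y (g h : homfam X Y) : g = h <-> fam1 g = fam1 h /\ fam2 g = fam2 h.
Proof.
split=> [->//|[/ffunP E1 /ffunP E2]]; apply: homfamP => -[] v.
  by have := E1 v; rewrite !tofamE.
by have := E2 v; rewrite !tofamE.
Qed.

Lemma intertwines_glue X Y h1 h2 :
  intertwines (X := res1 X) (Y := res1 Y) h1 -> intertwines (X := res2 X) (Y := res2 Y) h2 ->
  intertwines (glue h1 h2).
Proof. by move=> H1 H2 [] e; [apply: H1|apply: H2]. Qed.

Lemma is_hom_dbl X Y (h : homfam X Y) : is_hom h = is_hom (fam1 h) && is_hom (fam2 h).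
Proof.
apply/is_homP/andP => [H|[/is_homP H1 /is_homP H2]].
  split; apply/is_homP => e; rewrite !tofamE; first exact: (H (inl e : arr (dbl Q))).
  exact: (H (inr e : arr (dbl Q))).
by case=> e; [have := H1 e|have := H2 e]; rewrite !tofamE.
Qed.

Lemma forall_dbl (P : pred (vert (dbl Q))) :
  [forall v, P v] = [forall v : vert Q, P (inl v)] && [forall v : vert Q, P (inr v)].
Proof.
apply/forallP/andP => [H|[/forallP H1 /forallP H2] [] v //].
by split; apply/forallP => v; apply: H.
Qed.

Lemma is_iso_dbl X Y (h : homfam X Y) : is_iso h = is_iso (fam1 h) && is_iso (fam2 h).
Proof.
rewrite /is_iso is_hom_dbl forall_dbl andbACA; congr ((_ && _) && (_ && _)).
  by apply: eq_forallb => v; rewrite tofamE.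
by apply: eq_forallb => v; rewrite tofamE.
Qed.

Lemma repiso_dbl X Y : repiso X Y <-> repiso (res1 X) (res1 Y) /\ repiso (res2 X) (res2 Y).
Proof.
split=> [/isorepP/existsP[h]|[/isorepP/existsP[h1 H1] /isorepP/existsP[h2 H2]]].
  rewrite is_iso_dbl => /andP[H1 H2].
  by split; apply/isorepP/existsP; [exists (fam1 h)|exists (fam2 h)].
apply/isorepP/existsP; exists (glue_fam h1 h2).
by rewrite is_iso_dbl glue_fam1 glue_fam2 H1.
Qed.

Section Ses.
Variables X Z Y : rep (dbl Q) F.
Implicit Types s t : homfam Z Y * homfam Y X.

Definition ses1 s := (fam1 s.1, fam1 s.2).
Definition ses2 s := (fam2 s.1, fam2 s.2).

Lemma ses_dbl s :
  (s \in ses X Z Y) = (ses1 s \in ses (res1 X) (res1 Z) (res1 Y))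
                      && (ses2 s \in ses (res2 X) (res2 Z) (res2 Y)).
Proof.
pose ex m n p (A : 'M[F]_(m, n)) (B : 'M_(n, p)) :=
  [&& row_free A, row_full B & (A == kermx B)%MS].
rewrite !inE /is_ext !is_hom_dbl forall_dbl.
have -> : [forall v, ex _ _ _ (s.1 (inl v)) (s.2 (inl v))] =
          [forall v, ex _ _ _ ((ses1 s).1 v) ((ses1 s).2 v)].
  by apply: eq_forallb => v; rewrite !tofamE.
have -> : [forall v, ex _ _ _ (s.1 (inr v)) (s.2 (inr v))] =
          [forall v, ex _ _ _ ((ses2 s).1 v) ((ses2 s).2 v)].
  by apply: eq_forallb => v; rewrite !tofamE.
rewrite /ses1 /ses2 /=; move: (is_hom (fam1 s.1)) (is_hom (fam1 s.2)) (is_hom (fam2 s.1)).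
move: (is_hom (fam2 s.2)) [forall v, _] [forall v, _].
by do 6 case.
Qed.

Definition glue_ses (u : homfam (res1 Z) (res1 Y) * homfam (res1 Y) (res1 X))
    (w : homfam (res2 Z) (res2 Y) * homfam (res2 Y) (res2 X)) :
    homfam Z Y * homfam Y X :=
  (glue_fam u.1 w.1, glue_fam u.2 w.2).

Lemma glue_ses1 u w : ses1 (glue_ses u w) = u.
Proof. by case: u => u1 u2; rewrite /ses1 !glue_fam1. Qed.

Lemma glue_ses2 u w : ses2 (glue_ses u w) = w.
Proof. by case: w => w1 w2; rewrite /ses2 !glue_fam2. Qed.

Lemma ses_image1 s : fam1 (ses_image s) = ses_image (ses1 s).
Proof. by apply: homfamP => v; rewrite tofamE ffunE [RHS]ffunE tofamE. Qed.

Lemma ses_image2 s : fam2 (ses_image s) = ses_image (ses2 s).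
Proof. by apply: homfamP => v; rewrite tofamE ffunE [RHS]ffunE tofamE. Qed.

Lemma hallF_dbl :
  hallF X Z Y = (hallF (res1 X) (res1 Z) (res1 Y) * hallF (res2 X) (res2 Z) (res2 Y))%N.
Proof.
rewrite !hallFE; apply: (card_imset_prod glue_ses1 glue_ses2 ses_dbl) => s t _ _.
by rewrite fam_eq !ses_image1 !ses_image2.
Qed.

Lemma ext_equiv_dbl s t :
  ext_equiv s t = ext_equiv (ses1 s) (ses1 t) && ext_equiv (ses2 s) (ses2 t).
Proof.
apply/ext_equivP/andP => [[h [k [Hh hk kh st1 st2]]]|].
  split; apply/ext_equivP.
    exists (fun v => h (inl v)), (fun v => k (inl v)).
    split=> v.
    - exact: (Hh (inl v : arr (dbl Q))).
    - exact: hk.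
    - exact: kh.
    - by rewrite (fam1E s.1) (fam1E t.1); apply: st1.
    - by rewrite (fam1E s.2) (fam1E t.2); apply: st2.
  exists (fun v => h (inr v)), (fun v => k (inr v)).
  split=> v.
  - exact: (Hh (inr v : arr (dbl Q))).
  - exact: hk.
  - exact: kh.
  - by rewrite (fam2E s.1) (fam2E t.1); apply: st1.
  - by rewrite (fam2E s.2) (fam2E t.2); apply: st2.
case=> /ext_equivP[h1 [k1 [H1 hk1 kh1 st11 st12]]].
move=> /ext_equivP[h2 [k2 [H2 hk2 kh2 st21 st22]]].
exists (glue h1 h2), (glue k1 k2); split=> [|[]|[]|[] v|[] v].
- exact: intertwines_glue.
- exact: hk1.
- exact: hk2.
- exact: kh1.
- exact: kh2.
- by have := st11 v; rewrite (fam1E s.1) (fam1E t.1).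
- by have := st21 v; rewrite (fam2E s.1) (fam2E t.1).
- by have := st12 v; rewrite (fam1E s.2) (fam1E t.2).
- by have := st22 v; rewrite (fam2E s.2) (fam2E t.2).
Qed.

Lemma extY_dbl :
  #|extY X Z Y| = (#|extY (res1 X) (res1 Z) (res1 Y)| *
                   #|extY (res2 X) (res2 Z) (res2 Y)|)%N.
Proof.
rewrite !extYE; apply: (card_imset_prod glue_ses1 glue_ses2 ses_dbl) => s t _ tD.
have := tD; rewrite ses_dbl => /andP[tD1 tD2].
by rewrite !ses_classP // ext_equiv_dbl; split=> /andP.
Qed.

End Ses.

Lemma homset_dbl X Z :
  #|homset X Z| = (#|homset (res1 X) (res1 Z)| * #|homset (res2 X) (res2 Z)|)%N.
Proof.
rewrite -![#|homset _ _|](card_imset _ (@inj_id _)).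
apply: (card_imset_prod (@glue_fam1 X Z) (@glue_fam2 X Z)) => [h|g h _ _].
  by rewrite !inE is_hom_dbl.
exact: fam_eq.
Qed.

Lemma autset_dbl X : #|autset X| = (#|autset (res1 X)| * #|autset (res2 X)|)%N.
Proof.
rewrite -![#|autset _|](card_imset _ (@inj_id _)).
apply: (card_imset_prod (@glue_fam1 X X) (@glue_fam2 X X)) => [h|g h _ _].
  by rewrite !inE is_iso_dbl.
exact: fam_eq.
Qed.

End Double.

(** ** Direct sums *)

Section DirectSums.
Variables (Q : quiver) (F : finFieldType).
Implicit Types X Y Z : rep Q F.

Lemma mx1_eq0 n : n = 0%N -> 1%:M = 0 :> 'M[F]_n.
Proof. by move=> ->; exact: flatmx0. Qed.

Let blockE := (mul_col_mx, mul_mx_row, mul_row_col, mul0mx, mulmx0, mul1mx, mulmx1,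
  add0r, addr0, row_mx0, col_mx0).

Lemma dsum_congr X X' Y Y' : repiso X X' -> repiso Y Y' ->
  repiso (dsum X Y) (dsum X' Y').
Proof.
move=> [hX [kX [HX hkX khX]]] [hY [kY [HY hkY khY]]].
exists (fun v => block_mx (hX v) 0 0 (hY v)), (fun v => block_mx (kX v) 0 0 (kY v)).
split=> v /=; rewrite mulmx_block ?mulmx_block !blockE.
- by rewrite HX HY.
- by rewrite hkX hkY -scalar_mx_block.
- by rewrite khX khY -scalar_mx_block.
Qed.

Let swap_mx x y z : 'M[F]_(x + (y + z), y + (x + z)) :=
  col_mx (row_mx 0 (row_mx 1%:M 0))
         (col_mx (row_mx 1%:M 0) (row_mx 0 (row_mx 0 1%:M))).

Let swap_mxK x y z : swap_mx x y z *m swap_mx y x z = 1%:M.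
Proof.
rewrite /swap_mx !blockE scalar_mx_block [X in block_mx _ _ _ X]scalar_mx_block /block_mx.
by congr col_mx; rewrite -[LHS]/(block_mx 0 _ 0 _) block_mxEh col_mx0.
Qed.

(** This exchange, together with congruence, generates all permutations of the
    summands of an iterated direct sum. *)
Lemma dsumCA X Y Z : repiso (dsum X (dsum Y Z)) (dsum Y (dsum X Z)).
Proof.
exists (fun v => swap_mx _ _ _), (fun v => swap_mx _ _ _); split=> v.
- by rewrite /= /swap_mx /block_mx !blockE.
- exact: swap_mxK.
- exact: swap_mxK.
Qed.

Lemma zero_iso X Y : zero_rep X -> zero_rep Y -> repiso X Y.
Proof.
move=> X0 Y0; exists (fun=> 0), (fun=> 0).
by split=> v; rewrite ?mulmx0 ?mul0mx // mx1_eq0.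
Qed.

Lemma dsum0 X Y : zero_rep X -> repiso (dsum X Y) Y.
Proof.
move=> X0; exists (fun v => col_mx 0 1%:M), (fun v => row_mx 0 1%:M); split=> v /=.
- by rewrite /block_mx !blockE.
- by rewrite !blockE scalar_mx_block (mx1_eq0 (X0 v)) /block_mx !blockE.
- by rewrite !blockE.
Qed.

Section Big.
Variable (T : eqType).
Implicit Types (M N : T -> rep Q F) (s t : seq T).

Definition bigrep s M := \big[@dsum Q F/rep0 Q F]_(b <- s) M b.

Lemma bigrep_cons x s M : bigrep (x :: s) M = dsum (M x) (bigrep s M).
Proof. exact: big_cons. Qed.

Lemma bigrep_congr s M N :
  (forall x, x \in s -> repiso (M x) (N x)) -> repiso (bigrep s M) (bigrep s N).
Proof.
elim: s => [_|x s IHs MN]; first by rewrite /bigrep !big_nil; apply: repiso_refl.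
rewrite !bigrep_cons; apply: dsum_congr; first exact/MN/mem_head.
by apply: IHs => y ys; apply: MN; rewrite inE ys orbT.
Qed.

Lemma bigrep_pull x s t M :
  repiso (bigrep (s ++ x :: t) M) (bigrep (x :: s ++ t) M).
Proof.
elim: s => [|y s IHs]; first exact: repiso_refl.
rewrite !(cat_cons, bigrep_cons); apply: repiso_trans (dsumCA _ _ _).
by apply: dsum_congr (repiso_refl _) _; rewrite -bigrep_cons.
Qed.

Lemma bigrep_perm s t M : perm_eq s t -> repiso (bigrep s M) (bigrep t M).
Proof.
elim: s t => [|x s IHs] t; first by rewrite perm_sym => /perm_nilP ->; apply: repiso_refl.
move=> st; have xt : x \in t by rewrite -(perm_mem st) mem_head.
case/splitPr: xt st => t1 t2; rewrite perm_sym perm_catC cat_cons perm_cons perm_catC.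
rewrite perm_sym => /IHs st; apply: repiso_trans (repiso_sym (bigrep_pull _ _ _ _)).
by rewrite !bigrep_cons; apply: dsum_congr (repiso_refl _) st.
Qed.

Lemma bigrep_cat0l s t M :
  (forall x, x \in s -> zero_rep (M x)) -> repiso (bigrep (s ++ t) M) (bigrep t M).
Proof.
elim: s => [_|x s IHs Ms]; first exact: repiso_refl.
rewrite cat_cons bigrep_cons; apply: (repiso_trans (dsum0 _ _)).
  exact/Ms/mem_head.
by apply: IHs => y ys; apply: Ms; rewrite inE ys orbT.
Qed.

Lemma bigrep_cat0r s t M :
  (forall x, x \in t -> zero_rep (M x)) -> repiso (bigrep (s ++ t) M) (bigrep s M).
Proof.
move=> Mt; elim: s => [|x s IHs].
  by have := bigrep_cat0l [::] Mt; rewrite cats0.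
by rewrite cat_cons !bigrep_cons; apply: dsum_congr (repiso_refl _) IHs.
Qed.

End Big.

Lemma bigrep_map (T U : eqType) (f : T -> U) s (M : U -> rep Q F) :
  bigrep (map f s) M = bigrep s (M \o f).
Proof. exact: big_map. Qed.

End DirectSums.

(** ** Indecomposables of the double quiver *)

Section Extension.
Variables (Q : quiver) (F : finFieldType).
Implicit Types (X Y Z : rep Q F) (W : rep (dbl Q) F).

Definition extend1 X : rep (dbl Q) F :=
  @Rep (dbl Q) F (fun v : vert (dbl Q) => match v with inl i => rdim X i | inr _ => 0%N end)
    (fun e : arr (dbl Q) => match e with inl e => rmap X e | inr e => 0 end).

Definition extend2 X : rep (dbl Q) F :=
  @Rep (dbl Q) F (fun v : vert (dbl Q) => match v with inr i => rdim X i | inl _ => 0%N end)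
    (fun e : arr (dbl Q) => match e with inr e => rmap X e | inl e => 0 end).

Lemma res1_extend1 X : res1 (extend1 X) = X. Proof. by case: X. Qed.
Lemma res2_extend2 X : res2 (extend2 X) = X. Proof. by case: X. Qed.

Lemma zero_rep_dbl W : zero_rep W <-> zero_rep (res1 W) /\ zero_rep (res2 W).
Proof. by split=> [W0|[W1 W2] [] v]; [split=> v; apply: W0|apply: W1|apply: W2]. Qed.

(** Extending by zero turns a decomposition of the restriction into one of the
    whole representation. *)
Lemma indecomposable_res1 W :
  zero_rep (res2 W) -> indecomposable W -> indecomposable (res1 W).
Proof.
move=> W2 [Wn0 WI]; split=> [W1|Y Z /isorepP YZ]; first exact/Wn0/zero_rep_dbl.
have /WI[/zero_rep_dbl[]|/zero_rep_dbl[]] :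
    isorep W (dsum (extend1 Y) (extend1 Z)).
- apply/isorepP/repiso_dbl; split; last exact: zero_iso.
  by have -> : res1 (dsum (extend1 Y) (extend1 Z)) = dsum Y Z by case: (Y); case: (Z).
- by rewrite res1_extend1; left.
- by rewrite res1_extend1; right.
Qed.

Lemma indecomposable_res2 W :
  zero_rep (res1 W) -> indecomposable W -> indecomposable (res2 W).
Proof.
move=> W1 [Wn0 WI]; split=> [W2|Y Z /isorepP YZ]; first exact/Wn0/zero_rep_dbl.
have /WI[/zero_rep_dbl[]|/zero_rep_dbl[]] :
    isorep W (dsum (extend2 Y) (extend2 Z)).
- apply/isorepP/repiso_dbl; split; first exact: zero_iso.
  by have -> : res2 (dsum (extend2 Y) (extend2 Z)) = dsum Y Z by case: (Y); case: (Z).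
- by rewrite res2_extend2; left.
- by rewrite res2_extend2; right.
Qed.

Section Indec.
Variables (b : posroot Q) (X : rep Q F) (W : rep (dbl Q) F).
Hypothesis (Xb : is_indec_of b X).

(** The restriction is indecomposable with the right dimension vector, so the
    uniqueness in Gabriel's theorem identifies it. *)
Lemma res_rin1 : is_indec_of (rin1 b) W -> repiso (res1 W) X /\ zero_rep (res2 W).
Proof.
move=> [Wd WI _]; have W2 : zero_rep (res2 W).
  by move=> v; have := Wd (inr v); rewrite /= ffunE => -[].
split=> //; apply/isorepP; case: Xb => _ _; apply.
  by move=> i; have := Wd (inl i); rewrite /= ffunE.
exact: indecomposable_res1.
Qed.

Lemma res_rin2 : is_indec_of (rin2 b) W -> repiso (res2 W) X /\ zero_rep (res1 W).
Proof.
move=> [Wd WI _]; have W1 : zero_rep (res1 W).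
  by move=> v; have := Wd (inl v); rewrite /= ffunE => -[].
split=> //; apply/isorepP; case: Xb => _ _; apply.
  by move=> i; have := Wd (inr i); rewrite /= ffunE.
exact: indecomposable_res2.
Qed.

End Indec.

Variables (hd : hall_data Q) (hd2 : hall_data (dbl Q)).

Lemma res1_repM l m :
  repiso (res1 (repM (indec hd2 F) (mpair l m))) (repM (indec hd F) l).
Proof.
pose M b := res1 (indec hd2 F b).
have -> : res1 (repM (indec hd2 F) (mpair l m)) = bigrep (mpair l m) M.
  exact: (big_morph (@res1 Q F)).
apply: (repiso_trans (bigrep_perm _ (perm_eq_seq_mset _))).
apply: (repiso_trans (bigrep_cat0r _ _)) => [b /mapP[c _ ->]|].
  by have [] := res_rin2 (indecP hd F c) (indecP hd2 F (rin2 c)).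
rewrite bigrep_map; apply: bigrep_congr => c _.
by have [] := res_rin1 (indecP hd F c) (indecP hd2 F (rin1 c)).
Qed.

Lemma res2_repM l m :
  repiso (res2 (repM (indec hd2 F) (mpair l m))) (repM (indec hd F) m).
Proof.
pose M b := res2 (indec hd2 F b).
have -> : res2 (repM (indec hd2 F) (mpair l m)) = bigrep (mpair l m) M.
  exact: (big_morph (@res2 Q F)).
apply: (repiso_trans (bigrep_perm _ (perm_eq_seq_mset _))).
apply: (repiso_trans (bigrep_cat0l _ _)) => [b /mapP[c _ ->]|].
  by have [] := res_rin1 (indecP hd F c) (indecP hd2 F (rin1 c)).
rewrite bigrep_map; apply: bigrep_congr => c _.
by have [] := res_rin2 (indecP hd F c) (indecP hd2 F (rin2 c)).
Qed.

End Extension.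

(** * Generic Hall polynomials *)

Lemma primes_many N : exists s : seq nat, [/\ uniq s, size s = N & all prime s].
Proof.
elim: N => [|N [s [us ss ps]]]; first by exists [::].
have [p lt_p pp] := prime_above (\max_(q <- s) q).
exists (p :: s); split=> /=; last by rewrite pp.
  rewrite us andbT; apply: contraL lt_p => sp; rewrite -leqNgt.
  by rewrite (big_rem _ sp) leq_maxl.
by rewrite ss.
Qed.

Definition lmul (L1 L2 : laurent) : laurent :=
  Laurent (lnum L1 * lnum L2) (lden L1 + lden L2).

Lemma levalM (R : fieldType) (x : R) L1 L2 :
  leval x (lmul L1 L2) = leval x L1 * leval x L2.
Proof. by rewrite /leval rmorphM hornerM exprD invfM mulrACA. Qed.

Lemma v_neq0 : v != 0 :> K.
Proof. by rewrite expf_neq0 // tofrac_eq0 polyX_eq0. Qed.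

(** An integral Laurent polynomial is determined by its values at the square
    roots of the primes, as these are infinitely many. *)
Lemma inK_ext (L1 L2 : laurent) :
  (forall p, prime p ->
     leval (sqrtC p%:R : algC) L1 = leval (sqrtC p%:R : algC) L2) ->
  inK L1 = inK L2.
Proof.
move=> L12.
have E : lnum L1 * 'X^(lden L2) = lnum L2 * 'X^(lden L1).
  apply/eqP; rewrite -subr_eq0; set P := (X in X == 0).
  have intC_inj : injective (intr : int -> algC) by exact: intr_inj.
  rewrite -(inj_eq (map_inj_poly intC_inj (rmorph0 _))) rmorph0.
  apply/negPn/negP => nzP.
  have [s [us ss ps]] := primes_many (size (map_poly intr P : {poly algC})).
  pose rs := [seq sqrtC p%:R : algC | p <- s].
  suff: (size rs < size (map_poly intr P : {poly algC}))%N by rewrite size_map ss ltnn.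
  (* The square roots of distinct primes are distinct roots of P. *)
  apply: max_poly_roots nzP _ _; last first.
    rewrite map_inj_uniq // => p q /(congr1 (fun x => x ^+ 2)).
    by rewrite !sqrtCK => /eqP; rewrite eqr_nat => /eqP.
  apply/allP => _ /mapP[p sp ->]; have pp := allP ps p sp.
  have nz : sqrtC p%:R != 0 :> algC by rewrite sqrtC_eq0 pnatr_eq0 -lt0n prime_gt0.
  rewrite /root /P rmorphB !rmorphM /= !map_polyXn !hornerE subr_eq0.
  have := L12 p pp; rewrite /leval => /eqP.
  by rewrite eqr_div ?expf_neq0.
apply/eqP; rewrite /inK /leval eqr_div ?(expf_neq0 _ v_neq0) //.
have := congr1 (fun P => (map_poly intr P : {poly K}).[v]) E.
by rewrite !rmorphM /= !map_polyXn !hornerE => ->.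
Qed.

Lemma inK_eq0 (L : laurent) :
  (forall p, prime p -> leval (sqrtC p%:R : algC) L = 0) -> inK L = 0.
Proof.
move=> L0; have -> : 0 = inK (Laurent 0 0).
  by rewrite /inK /leval /= rmorph0 horner0 mul0r.
by apply: inK_ext => p pp; rewrite L0 // /leval /= rmorph0 horner0 mul0r.
Qed.

Lemma inKM L1 L2 L : (forall p, prime p ->
     leval (sqrtC p%:R : algC) L =
     leval (sqrtC p%:R : algC) L1 * leval (sqrtC p%:R : algC) L2) ->
  inK L = inK L1 * inK L2.
Proof. by move=> E; rewrite /inK -levalM; apply: inK_ext => p pp; rewrite E ?levalM. Qed.

(** ** Roots and multiplicities of the double quiver *)

Section Forms.
Variable Q : quiver.
Implicit Types x y z : zvec Q.

Lemma eulerDl x y z : euler (x + y) z = euler x z + euler y z.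
Proof.
rewrite /euler; under eq_bigr do rewrite ffunE mulrDl.
under [X in _ - X]eq_bigr do rewrite ffunE mulrDl.
by rewrite !big_split /= opprD addrACA.
Qed.

Lemma eulerDr x y z : euler x (y + z) = euler x y + euler x z.
Proof.
rewrite /euler; under eq_bigr do rewrite ffunE mulrDr.
under [X in _ - X]eq_bigr do rewrite ffunE mulrDr.
by rewrite !big_split /= opprD addrACA.
Qed.

Lemma euler_dbl (a b c d : zvec Q) :
  euler (zin1 a + zin2 b) (zin1 c + zin2 d) = euler a c + euler b d.
Proof.
rewrite /euler !big_sumType /= opprD addrACA; congr (_ + _); congr (_ - _);
  by apply: eq_bigr => i _; rewrite !ffunE ?addr0 ?add0r.
Qed.

Lemma sform_dbl (a b c d : zvec Q) :
  sform (zin1 a + zin2 b) (zin1 c + zin2 d) = sform a c + sform b d.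
Proof. by rewrite /sform !euler_dbl addrACA. Qed.

Lemma zin1D x y : zin1 (x + y) = zin1 x + zin1 y.
Proof. by apply/ffunP => -[] i; rewrite !ffunE ?addr0. Qed.

Lemma zin2D x y : zin2 (x + y) = zin2 x + zin2 y.
Proof. by apply/ffunP => -[] i; rewrite !ffunE ?addr0. Qed.

Lemma zin1_0 : zin1 (0 : zvec Q) = 0.
Proof. by apply/ffunP => -[] i; rewrite !ffunE. Qed.

Lemma zin2_0 : zin2 (0 : zvec Q) = 0.
Proof. by apply/ffunP => -[] i; rewrite !ffunE. Qed.

Definition zres1 (x : zvec (dbl Q)) : zvec Q := [ffun i => x (inl i : vert (dbl Q))].
Definition zres2 (x : zvec (dbl Q)) : zvec Q := [ffun i => x (inr i : vert (dbl Q))].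

Lemma zres1K a b : zres1 (zin1 a + zin2 b) = a.
Proof. by apply/ffunP => i; rewrite !ffunE addr0. Qed.

Lemma zres2K a b : zres2 (zin1 a + zin2 b) = b.
Proof. by apply/ffunP => i; rewrite !ffunE add0r. Qed.

Lemma zresE (x : zvec (dbl Q)) : zin1 (zres1 x) + zin2 (zres2 x) = x.
Proof. by apply/ffunP => -[] i; rewrite !ffunE ?addr0 ?add0r. Qed.

Lemma rho_zpair a b : rho_z (swap Q) (zin1 a + zin2 b) = zin1 b + zin2 a.
Proof. by apply/ffunP => -[] i; rewrite !ffunE ?addr0 ?add0r. Qed.

Lemma zin2_simple i : zin2 (simple_root i) = simple_root (inr i : vert (dbl Q)).
Proof. by apply/ffunP => -[] j; rewrite !ffunE. Qed.

Lemma euler0l x : euler 0 x = 0.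
Proof. by rewrite /euler !big1 ?subr0 // => i _; rewrite ffunE mul0r. Qed.

Lemma euler0r x : euler x 0 = 0.
Proof. by rewrite /euler !big1 ?subr0 // => i _; rewrite ffunE mulr0. Qed.

Lemma zin1E x : zin1 x = zin1 x + zin2 0.
Proof. by rewrite zin2_0 addr0. Qed.

Lemma zin2E x : zin2 x = zin1 0 + zin2 x.
Proof. by rewrite zin1_0 add0r. Qed.

Lemma sform_zin1 x y : sform (zin1 x) (zin1 y) = sform x y.
Proof. by rewrite (zin1E x) (zin1E y) sform_dbl {2}/sform !euler0l !addr0. Qed.

Lemma sform_zin2 x y : sform (zin2 x) (zin2 y) = sform x y.
Proof. by rewrite (zin2E x) (zin2E y) sform_dbl {1}/sform !euler0l !add0r. Qed.

Lemma sform_zin12 x y : sform (zin1 x) (zin2 y) = 0.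
Proof. by rewrite (zin1E x) (zin2E y) sform_dbl /sform !euler0l !euler0r. Qed.

Lemma sform_zin21 x y : sform (zin2 x) (zin1 y) = 0.
Proof. by rewrite /sform addrC -/(sform _ _) sform_zin12. Qed.

Lemma qroot_dbl (x : zvec (dbl Q)) : qroot x ->
  (exists2 y, qroot y & x = zin1 y) \/ (exists2 y, qroot y & x = zin2 y).
Proof.
elim=> [[i|i]|[i|i] _ _ [[y ry ->]|[y ry ->]]].
- by left; exists (simple_root i); [constructor|rewrite zin1_simple].
- by right; exists (simple_root i); [constructor|rewrite zin2_simple].
- left; exists (y - simple_root i *~ sform y (simple_root i)); first by constructor.
  rewrite -zin1_simple sform_zin1.
  by apply/ffunP => -[] j; rewrite !(ffunE, zvecMz) ?mul0rz ?subr0.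
- by right; exists y; rewrite // -zin1_simple sform_zin21 mulr0z subr0.
- by left; exists y; rewrite // -zin2_simple sform_zin12 mulr0z subr0.
- right; exists (y - simple_root i *~ sform y (simple_root i)); first by constructor.
  rewrite -zin2_simple sform_zin2.
  by apply/ffunP => -[] j; rewrite !(ffunE, zvecMz) ?mul0rz ?subr0.
Qed.

Lemma posroot_dbl (c : posroot (dbl Q)) : (exists b, c = rin1 b) \/ (exists b, c = rin2 b).
Proof.
have /asboolP[/qroot_dbl[[y ry cE]|[y ry cE]] cp] := valP c.
  have yp : `[< is_posroot y >].
    by apply/asboolP; split=> // i; have := cp (inl i); rewrite cE ffunE.
  by left; exists (exist _ y yp); apply: val_inj.
have yp : `[< is_posroot y >].
  by apply/asboolP; split=> // i; have := cp (inr i); rewrite cE ffunE.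
by right; exists (exist _ y yp); apply: val_inj.
Qed.

End Forms.

Section Multiplicities.
Variable Q : quiver.
Hypothesis root_neq0 : forall b : posroot Q, val b != 0.
Implicit Types l m : mults Q.

Lemma rin1_inj : injective (@rin1 Q).
Proof.
move=> b c /(congr1 val)/= /ffunP E; apply/val_inj/ffunP => i.
by have := E (inl i); rewrite !ffunE.
Qed.

Lemma rin2_inj : injective (@rin2 Q).
Proof.
move=> b c /(congr1 val)/= /ffunP E; apply/val_inj/ffunP => i.
by have := E (inr i); rewrite !ffunE.
Qed.

Lemma rin12_neq (b c : posroot Q) : rin1 b != rin2 c.
Proof.
apply/eqP => /(congr1 val)/= /ffunP E; have /eqP[] := root_neq0 b.
by apply/ffunP => i; have := E (inl i); rewrite !ffunE.
Qed.

Lemma mpair_rin1 l m b : mpair l m (rin1 b) = l b.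
Proof.
rewrite mset_seqE count_cat !count_map -[RHS]count_mem_mset -[RHS]addn0.
congr (_ + _)%N; first by apply: eq_count => c; rewrite /= (inj_eq rin1_inj).
by rewrite -(count_pred0 m); apply: eq_count => c; rewrite /= eq_sym (negbTE (rin12_neq _ _)).
Qed.

Lemma mpair_rin2 l m b : mpair l m (rin2 b) = m b.
Proof.
rewrite mset_seqE count_cat !count_map -[RHS]count_mem_mset -[RHS]add0n.
congr (_ + _)%N; last by apply: eq_count => c; rewrite /= (inj_eq rin2_inj).
by rewrite -(count_pred0 l); apply: eq_count => c; rewrite /= (negbTE (rin12_neq _ _)).
Qed.

Lemma mpair_inj l m l' m' : mpair l m = mpair l' m' -> l = l' /\ m = m'.
Proof.
by move=> E; split; apply/msetP => b; rewrite -?(mpair_rin1 l m b) -?(mpair_rin2 l m b) E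
  ?mpair_rin1 ?mpair_rin2.
Qed.

Lemma mpair_surj (n : mults (dbl Q)) : exists l m, n = mpair l m.
Proof.
have [s1 [s2 sE]] : exists s1 s2 : seq (posroot Q),
    perm_eq n ([seq rin1 b | b <- s1] ++ [seq rin2 b | b <- s2]).
  elim: (n : seq _) => [|c s [s1 [s2 sE]]]; first by exists [::], [::].
  case: (posroot_dbl c) => -[b ->].
    by exists (b :: s1), s2; rewrite /= perm_cons.
  by exists s1, (b :: s2); rewrite /= perm_sym perm_catC cat_cons perm_cons perm_catC perm_sym.
exists (seq_mset s1), (seq_mset s2); rewrite -[LHS]seq_mset_id; apply/eq_seq_msetP.
apply: (perm_trans sE); rewrite perm_sym.
by apply: perm_cat; apply: perm_map; apply: perm_eq_seq_mset.
Qed.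

Lemma dvec_mpair l m : dvec (mpair l m) = zin1 (dvec l) + zin2 (dvec m).
Proof.
rewrite /dvec (perm_big _ (perm_eq_seq_mset _)) big_cat !big_map /=.
by rewrite (big_morph _ (@zin1D Q) (zin1_0 Q)) (big_morph _ (@zin2D Q) (zin2_0 Q)).
Qed.

Lemma rho_mpair l m : rho_m (swap Q) (mpair l m) = mpair m l.
Proof.
have r12 b : rho_root_act (swap Q) (rin1 b) = rin2 b.
  by apply: val_inj; rewrite /= rho_zin1.
have r21 b : rho_root_act (swap Q) (rin2 b) = rin1 b by rewrite -r12 rho_root_actK.
apply/msetP => c; rewrite rho_mE; case: (posroot_dbl c) => -[b ->].
  by rewrite r12 mpair_rin1 mpair_rin2.
by rewrite r21 mpair_rin1 mpair_rin2.
Qed.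

(** ** Finiteness of the index sets *)

Definition height (x : zvec Q) : int := \sum_i x i.

Lemma heightD x y : height (x + y) = height x + height y.
Proof. by rewrite /height -big_split; apply: eq_bigr => i _; rewrite ffunE. Qed.

Lemma root_ge0 (b : posroot Q) i : 0 <= val b i.
Proof. by have /asboolP[_] := valP b. Qed.

Lemma height_root (b : posroot Q) : 1 <= height (val b).
Proof.
rewrite -gtz0_ge1 lt_def sumr_ge0 ?andbT; last by move=> i _; apply: root_ge0.
apply: contra (root_neq0 b) => /eqP h0; apply/eqP/ffunP => i; rewrite ffunE.
move: h0 => /eqP; rewrite psumr_eq0 => [/allP/(_ i (mem_index_enum _))/eqP //|j _].
exact: root_ge0.
Qed.

Lemma height_dvec l : height (dvec l) = \sum_(b <- l) height (val b).
Proof.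
rewrite /dvec; apply: (big_morph _ heightD).
by rewrite /height big1 // => i _; rewrite ffunE.
Qed.

Lemma height_ge0 l : 0 <= height (dvec l).
Proof. by rewrite height_dvec sumr_ge0 // => b _; apply: le_trans (height_root b). Qed.

Lemma coord_le_height l b i : b \in l -> val b i <= height (dvec l).
Proof.
move=> bl; rewrite height_dvec (big_rem b bl) /= /height (bigD1 i) //= -addrA lerDl.
apply: addr_ge0; first by apply: sumr_ge0 => j _; apply: root_ge0.
by apply: sumr_ge0 => c _; apply: le_trans (height_root c).
Qed.

Lemma mult_le_height l b : (l b)%:Z <= height (dvec l).
Proof.
rewrite -count_mem_mset; apply: (@le_trans _ _ (size l)%:Z); first by rewrite lez_nat count_size.
rewrite height_dvec; elim: (l : seq _) => [|c s IHs]; first by rewrite big_nil.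
by rewrite big_cons /= -add1n PoszD lerD // height_root.
Qed.

(** Positive roots have nonnegative coordinates and are not zero, so only
    finitely many multiplicity functions have height at most [N]; therefore
    every sum over the indices of Hall polynomials is finite. *)
Lemma bounded_mults (N : nat) :
  exists E : seq (mults Q), uniq E /\ forall l, height (dvec l) <= N%:Z -> l \in E.
Proof.
(* A function of height at most N vanishes outside the roots with coordinates at
   most N, and its values are at most N; so [code] is injective on these. *)
pose code l : {ffun {ffun vert Q -> 'I_N.+1} -> 'I_N.+1} :=
  [ffun f : {ffun vert Q -> 'I_N.+1} =>
     inord (count (fun b : posroot Q => [forall i, val b i == (f i)%:Z]) l)].
pose A := [set l : mults Q | height (dvec l) <= N%:Z]%classic.
have codeI l l' : A l -> A l' -> code l = code l' -> forall b, b \in l -> l b = l' b.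
  move=> Al Al' /ffunP E b bl; pose f := [ffun i => inord `|val b i|%N : 'I_N.+1].
  have fE i : (f i)%:Z = val b i.
    have b0 := root_ge0 b i; have bN := le_trans (coord_le_height i bl) Al.
    by rewrite ffunE inordK ?gez0_abs // ltnS -lez_nat gez0_abs.
  have count_f (n : mults Q) : count (fun c : posroot Q => [forall i, val c i == (f i)%:Z]) n = n b.
    rewrite -count_mem_mset; apply: eq_count => c /=; apply/forallP/eqP => [H|-> i].
      by apply/val_inj/ffunP => i; rewrite (eqP (H i)) fE.
    by rewrite fE.
  have := congr1 val (E f); rewrite !ffunE !count_f /= !inordK //.
    by have := le_trans (mult_le_height l' b) Al'; rewrite lez_nat.
  by have := le_trans (mult_le_height l b) Al; rewrite lez_nat.
pose pick c := if pselect (exists l, A l /\ code l = c) is left H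
               then Some (projT1 (cid H)) else None.
exists (undup (pmap pick (enum predT))); split=> [|l Al]; first exact: undup_uniq.
rewrite mem_undup mem_pmap; apply/mapP; exists (code l); first by rewrite mem_enum.
rewrite /pick; case: pselect => [H|[]]; last by exists l.
case: (cid H) => l' [Al' ll'] /=; congr Some; apply/msetP => b.
have [bl|bl] := boolP (b \in l); first exact: codeI bl.
have [bl'|bl'] := boolP (b \in l'); first exact/esym/(codeI l').
by rewrite (mset_eq0P bl) (mset_eq0P bl').
Qed.

Lemma fsum_seq (V : nmodType) (T : choiceType) (E : seq T) (G : T -> V) :
  uniq E -> (forall x, x \notin E -> G x = 0) -> fsum G = \sum_(x <- E) G x.
Proof.
move=> uE G0; rewrite /fsum (fsbigE E) //; last by move=> x _; apply: G0.
by apply: eq_bigl => x; rewrite in_setT.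
Qed.

Lemma fsum0 (V : nmodType) (T : choiceType) (G : T -> V) :
  (forall x, G x = 0) -> fsum G = 0.
Proof. by move=> G0; rewrite (@fsum_seq _ _ [::]) ?big_nil. Qed.

Lemma fsum_dbl (V : nmodType) (E : seq (mults Q)) (G : mults (dbl Q) -> V) :
  uniq E ->
  (forall l m, ~~ ((l \in E) && (m \in E)) -> G (mpair l m) = 0) ->
  fsum G = \sum_(l <- E) \sum_(m <- E) G (mpair l m).
Proof.
move=> uE G0; rewrite (@fsum_seq _ _ [seq mpair l m | l <- E, m <- E]).
- by rewrite big_allpairs_dep.
- by apply: allpairs_uniq => // -[l m] [l' m'] _ _ /mpair_inj[/= -> ->].
move=> n; have [l [m ->]] := mpair_surj n; move=> lm; apply: G0; apply: contra lm.
by case/andP=> lE mE; apply/allpairsP; exists (l, m).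
Qed.

End Multiplicities.

(** * Structure constants *)

Section StructureConstants.
Variables (Q : quiver) (hd : hall_data Q).
Implicit Types l m n : mults Q.

Lemma card_Fp_nat p : prime p -> #|'F_p|%:R = p%:R :> algC.
Proof. by move=> pp; rewrite card_Fp. Qed.

(** A positive root is the dimension vector of an indecomposable representation,
    which is not zero. *)
Lemma root_neq0 (b : posroot Q) : val b != 0.
Proof.
have [bd [bn0 _] _] := indecP hd 'F_2 b; apply/eqP => b0; apply: bn0 => i.
by have := bd i; rewrite b0 ffunE => -[].
Qed.

Lemma rdim_repM (F : finFieldType) l i : (rdim (repM (indec hd F) l) i)%:Z = dvec l i.
Proof.
rewrite /repM /dvec; elim: (l : seq _) => [|b s IHs]; first by rewrite !big_nil ffunE.
by rewrite !big_cons ffunE /= PoszD IHs; have [->] := indecP hd F b.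
Qed.

Lemma ses_rdim (F : finFieldType) (X Z Y : rep Q F) :
  (0 < #|ses X Z Y|)%N -> forall i, rdim Y i = (rdim X i + rdim Z i)%N.
Proof.
case/card_gt0P => s; rewrite inE => /is_extP[_ _ f1 f2 s12] i.
have := eqP (f1 i); rewrite (eqmxP (s12 i)) mxrank_ker (eqP (f2 i)) => <-.
by rewrite subnKC // -(eqP (f2 i)) rank_leq_row.
Qed.

Lemma ses_eq0 (F : finFieldType) l m n : dvec n != dvec l + dvec m ->
  ses (repM (indec hd F) l) (repM (indec hd F) m) (repM (indec hd F) n) = finset.set0.
Proof.
move=> lmn; apply/eqP; rewrite -cards_eq0 -leqn0 leqNgt; apply: contra lmn => /ses_rdim E.
by apply/eqP/ffunP => i; rewrite ffunE -!(rdim_repM F) E PoszD.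
Qed.

(** An extension adds dimension vectors, so Hall polynomials with inhomogeneous
    indices vanish. *)
Lemma hf_dvec l m n : inK (hf hd l m n) != 0 -> dvec n = dvec l + dvec m.
Proof.
apply: contraNeq => lmn; apply/eqP/inK_eq0 => p pp.
by rewrite -card_Fp_nat // hfP hallFE ses_eq0 // imset0 cards0.
Qed.

Lemma hg_dvec l m n : inK (hg hd l m n) != 0 -> dvec n = dvec l + dvec m.
Proof.
apply: contraNeq => lmn; apply/eqP/inK_eq0 => p pp.
by rewrite -card_Fp_nat // hgP extYE ses_eq0 // imset0 cards0 mul0r.
Qed.

Variable hd2 : hall_data (dbl Q).

(** A representation of the double quiver is a pair of representations, so at every
    prime the Hall number is a product; the same holds for the next two families. *)
Lemma hf_mpair l1 l2 m1 m2 n1 n2 :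
  inK (hf hd2 (mpair l1 l2) (mpair m1 m2) (mpair n1 n2)) =
  inK (hf hd l1 m1 n1) * inK (hf hd l2 m2 n2).
Proof.
apply: inKM => p pp; rewrite -card_Fp_nat // !hfP -natrM hallF_dbl.
by congr (_ * _)%N%:R; apply: hallF_iso;
  (apply: (res1_repM _ hd hd2) || apply: (res2_repM _ hd hd2)).
Qed.

Lemma hg_mpair l1 l2 m1 m2 n1 n2 :
  inK (hg hd2 (mpair l1 l2) (mpair m1 m2) (mpair n1 n2)) =
  inK (hg hd l1 m1 n1) * inK (hg hd l2 m2 n2).
Proof.
apply: inKM => p pp; rewrite -card_Fp_nat // !hgP extY_dbl homset_dbl.
rewrite !natrM invfM mulrACA.
by congr (_%:R / _%:R * (_%:R / _%:R)); (apply: extY_iso || apply: homset_iso);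
  (apply: (res1_repM _ hd hd2) || apply: (res2_repM _ hd hd2)).
Qed.

Lemma ha_mpair l1 l2 :
  inK (ha hd2 (mpair l1 l2)) = inK (ha hd l1) * inK (ha hd l2).
Proof.
apply: inKM => p pp; rewrite -card_Fp_nat // !haP autset_dbl natrM.
by congr (_%:R * _%:R); apply: autset_iso; [apply: (res1_repM _ hd hd2)|apply: (res2_repM _ hd hd2)].
Qed.

End StructureConstants.

(** * Linear maps defined on bases *)

Lemma linear_scale (V W : lmodType K) (f : V -> W) (k : K) x :
  linear f -> f (k *: x) = k *: f x.
Proof.
move=> lf; have f0 : f 0 = 0.
  by have := lf (-1) 0 0; rewrite scaler0 addr0 scaleN1r addNr.
by have := lf k x 0; rewrite f0 !addr0.
Qed.

Lemma linear_bigsum (V W : lmodType K) (f : V -> W) (T : Type) (s : seq T) (x : T -> V) :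
  linear f -> f (\sum_(t <- s) x t) = \sum_(t <- s) f (x t).
Proof.
move=> lf; have fD y z : f (y + z) = f y + f z by have := lf 1 y z; rewrite !scale1r.
by apply: (big_morph f fD); rewrite -(scale0r 0) linear_scale // scale0r.
Qed.

Lemma linear_lsum (V W : lmodType K) (f : V -> W) (T : Type) (s : seq T) (c : T -> K)
    (b : T -> V) :
  linear f -> f (\sum_(t <- s) c t *: b t) = \sum_(t <- s) c t *: f (b t).
Proof.
by move=> lf; rewrite linear_bigsum //; apply: eq_bigr => t _; rewrite linear_scale.
Qed.

Lemma basis_eq (V W : lmodType K) (T : choiceType) (b : T -> V) (f g : V -> W) :
  is_basis b -> linear f -> linear g -> (forall t, f (b t) = g (b t)) -> f =1 g.
Proof.
move=> bP lf lg fg x; have [c [-> _]] := bP x.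
by rewrite !linear_lsum //; apply: eq_bigr => t _; rewrite fg.
Qed.

Section Extend.
Variables (V W : lmodType K) (T : choiceType) (b : T -> V).
Hypothesis bP : is_basis b.

Let lcomb (W' : lmodType K) (f : T -> W') (c : {fsfun T -> K with 0}) : W' :=
  \sum_(t <- finsupp c) c t *: f t.

Let lcomb_widen (W' : lmodType K) (f : T -> W') (c : {fsfun T -> K with 0}) (A : {fset T}) :
  (finsupp c `<=` A)%fset -> lcomb f c = \sum_(t <- A) c t *: f t.
Proof.
move=> cA; apply: big_fset_incl => // t _ /fsfun_dflt ->; exact: scale0r.
Qed.

Lemma basis_extend (f : T -> W) : exists g : V -> W, linear g /\ forall t, g (b t) = f t.
Proof.
pose coord x := projT1 (cid (bP x)).
have coordE x : x = lcomb b (coord x) by rewrite /coord; case: cid => c [].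
have coord_unique x c : x = lcomb b c -> coord x = c.
  by rewrite /coord; case: cid => c' [? uc'] /= xc; apply: uc'.
exists (fun x => lcomb f (coord x)); split=> [a x y|t].
  pose A := (finsupp (coord x) `|` finsupp (coord y))%fset.
  pose c : {fsfun T -> K with 0} := [fsfun t in A => a * coord x t + coord y t].
  have cE t : t \in A -> c t = a * coord x t + coord y t by rewrite /c fsfunE => ->.
  have comb (W' : lmodType K) (h : T -> W') :
      lcomb h c = a *: lcomb h (coord x) + lcomb h (coord y).
    rewrite (@lcomb_widen _ _ _ A) ?(@lcomb_widen _ _ (coord x) A)
      ?(@lcomb_widen _ _ (coord y) A).
    - rewrite scaler_sumr -big_split; apply: eq_big_seq => t tA /=.
      by rewrite cE // scalerDl scalerA.
    - exact: fsubsetUr.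
    - exact: fsubsetUl.
    - exact: finsupp_sub.
  rewrite (coord_unique (a *: x + y) c) ?comb //.
  by rewrite {1}(coordE x) {1}(coordE y).
pose c : {fsfun T -> K with 0} := [fsfun x in [fset t]%fset => 1 : K].
have single (W' : lmodType K) (h : T -> W') : lcomb h c = h t.
  rewrite (@lcomb_widen _ _ _ [fset t]%fset); last exact: finsupp_sub.
  by rewrite big_seq_fset1 /c fsfunE inE eqxx scale1r.
by rewrite (coord_unique (b t) c) single.
Qed.

End Extend.

Lemma bilinear_extend (V1 V2 W : lmodType K) (T1 T2 : choiceType) (b1 : T1 -> V1)
    (b2 : T2 -> V2) (f : T1 -> T2 -> W) : is_basis b1 -> is_basis b2 ->
  exists h : V1 -> V2 -> W, bilinear_map h /\ forall t s, h (b1 t) (b2 s) = f t s.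
Proof.
move=> b1P b2P.
have /choice[h1 h1P] s : exists g : V1 -> W, linear g /\ forall t, g (b1 t) = f t s.
  exact: (basis_extend b1P).
have /choice[h hP] x : exists g : V2 -> W, linear g /\ forall s, g (b2 s) = h1 s x.
  exact: (basis_extend b2P).
exists h; split=> [|t s]; last by rewrite (hP _).2 (h1P _).2.
split=> [x|y]; first exact: (hP x).1.
move=> a x x'; move: y; apply: (basis_eq b2P).
- exact: (hP _).1.
- move=> c y y'; rewrite (hP x).1 (hP x').1 !scalerDr !scalerA (mulrC a) -!scalerA.
  by rewrite addrACA.
- by move=> s; rewrite !(hP _).2 (h1P s).1.
Qed.

(** * The comparison of the two algebras *)

Section Reorder.
Variables (V : nmodType) (T : Type) (E : seq T).
Local Notation "'S_' x , G" := (\sum_(x <- E) G) (at level 200, x name).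

Lemma sum_front3 (G : T -> T -> T -> V) :
  (S_ a, S_ b, S_ c, G a b c) = (S_ c, S_ a, S_ b, G a b c).
Proof. by under eq_bigr do rewrite exchange_big; apply: exchange_big. Qed.

Lemma sum_front4 (G : T -> T -> T -> T -> V) :
  (S_ a, S_ b, S_ c, S_ d, G a b c d) = (S_ d, S_ a, S_ b, S_ c, G a b c d).
Proof. by under eq_bigr do rewrite sum_front3; apply: exchange_big. Qed.

Lemma sum_front5 (G : T -> T -> T -> T -> T -> V) :
  (S_ a, S_ b, S_ c, S_ d, S_ e, G a b c d e) =
  (S_ e, S_ a, S_ b, S_ c, S_ d, G a b c d e).
Proof. by under eq_bigr do rewrite sum_front4; apply: exchange_big. Qed.

Lemma sum_front6 (G : T -> T -> T -> T -> T -> T -> V) :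
  (S_ a, S_ b, S_ c, S_ d, S_ e, S_ f, G a b c d e f) =
  (S_ f, S_ a, S_ b, S_ c, S_ d, S_ e, G a b c d e f).
Proof. by under eq_bigr do rewrite sum_front5; apply: exchange_big. Qed.

Lemma sum_front7 (G : T -> T -> T -> T -> T -> T -> T -> V) :
  (S_ a, S_ b, S_ c, S_ d, S_ e, S_ f, S_ g, G a b c d e f g) =
  (S_ g, S_ a, S_ b, S_ c, S_ d, S_ e, S_ f, G a b c d e f g).
Proof. by under eq_bigr do rewrite sum_front6; apply: exchange_big. Qed.

(** The left order is that of the product in the iHall algebra, where the index of
    the basis comes first; the right order is that of the product in the double,
    where the two components of each coproduct are adjacent and the products in the
    extended Hall algebra are expanded last. *)
Lemma sum_reorder (G : T -> T -> T -> T -> T -> T -> T -> T -> V) :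
  (S_ t1, S_ t2, S_ n1, S_ n2, S_ c1, S_ c2, S_ d1, S_ d2,
     G t1 t2 n1 n2 c1 c2 d1 d2) =
  (S_ d1, S_ n1, S_ d2, S_ n2, S_ c1, S_ c2, S_ t1, S_ t2,
     G t1 t2 n1 n2 c1 c2 d1 d2).
Proof.
rewrite [LHS]sum_front7; apply: eq_bigr => d1 _; rewrite [LHS]sum_front3; apply: eq_bigr => n1 _.
rewrite [LHS]sum_front6; apply: eq_bigr => d2 _; rewrite [LHS]sum_front3; apply: eq_bigr => n2 _.
by rewrite [LHS]sum_front3; apply: eq_bigr => c1 _; rewrite [LHS]sum_front3.
Qed.

End Reorder.

Lemma sum_delta (R : pzRingType) (V : lmodType R) (T : eqType) (E : seq T) (x : T)
    (G : T -> V) : uniq E -> x \in E ->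
  \sum_(y <- E) (x == y)%:R *: G y = G x.
Proof.
move=> uE xE; rewrite (bigD1_seq x) //= eqxx scale1r big1 ?addr0 // => y yx.
by rewrite eq_sym (negbTE yx) scale0r.
Qed.

Lemma v_exprD (m n : int) : v ^ m * v ^ n = v ^ (m + n).
Proof. by rewrite expfzDr // v_neq0. Qed.

Lemma v_exprNK (m : int) : v ^ (- m) * v ^ m = 1.
Proof. by rewrite v_exprD addNr. Qed.

Lemma factors_neq0 (R : idomainType) (w x f1 f2 f3 f4 g1 g2 : R) :
  w * x * (f1 * f2) * (f3 * f4) * (g1 * g2) != 0 ->
  [/\ f1 != 0 /\ f2 != 0, f3 != 0 /\ f4 != 0 & g1 != 0 /\ g2 != 0].
Proof.
rewrite !mulf_eq0 !negb_or => /andP[/andP[/andP[_ /andP[? ?]] /andP[? ?]] /andP[? ?]].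
by [].
Qed.

Section FormsBilinear.
Variable Q : quiver.
Implicit Types x y z : zvec Q.

Lemma sformDl x y z : sform (x + y) z = sform x z + sform y z.
Proof. by rewrite /sform eulerDl eulerDr addrACA. Qed.

Lemma sformDr x y z : sform x (y + z) = sform x y + sform x z.
Proof. by rewrite /sform eulerDl eulerDr addrACA. Qed.

Lemma sformC x y : sform x y = sform y x.
Proof. by rewrite /sform addrC. Qed.

End FormsBilinear.

(** ** The iHall algebra of the double quiver *)

Section IHall.
Variables (Q : quiver) (hd : hall_data Q) (hd2 : hall_data (dbl Q)).
Variable H : iHall_algebra hd2 (swap Q).
Implicit Types (l m n c d t : mults Q) (a b : zvec Q).

Local Notation f l m n := (inK (hf hd l m n)).
Local Notation g l m n := (inK (hg hd l m n)).
Local Notation A l := (inK (ha hd l)).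

Definition ihall_u l m : H := ih_u H (mpair l m).
Definition ihall_K a b : H := ih_K H (zin1 a + zin2 b).

Lemma ihall_KK a b a' b' : ihall_K a b * ihall_K a' b' = ihall_K (a + a') (b + b').
Proof. by rewrite /ihall_K ih_KK zin1D zin2D addrACA. Qed.

Lemma ihall_uK a b l m : ihall_u l m * ihall_K a b =
  v ^ (sform a (dvec l) + sform b (dvec m) - sform b (dvec l) - sform a (dvec m))
  *: (ihall_K a b * ihall_u l m).
Proof.
rewrite /ihall_u /ihall_K ih_Ku scalerA v_exprD rho_zpair dvec_mpair !sform_dbl.
set e := (X in v ^ X); have -> : e = 0 by rewrite /e; lia.
by rewrite scale1r.
Qed.

(** The structure constant of the iHall algebra of the double quiver, with every
    index split along the two copies of the quiver; [d1] and [d2] change places in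
    the second pair of factors because of the involution. *)
Definition ihall_coef (l1 l2 m1 m2 t1 t2 n1 n2 c1 c2 d1 d2 : mults Q) : K :=
  v ^ (euler (dvec d1) (dvec t1) + euler (dvec d2) (dvec t2)
       - (euler (dvec d2) (dvec t1) + euler (dvec d1) (dvec t2))
       - (euler (dvec l1) (dvec m1) + euler (dvec l2) (dvec m2))
       + (euler (dvec n1) (dvec c1) + euler (dvec n2) (dvec c2)) *+ 2)
  * (A d1 * A d2) * (f d1 n1 l1 * f d2 n2 l2) * (f c1 d2 m1 * f c2 d1 m2)
  * (g n1 c1 t1 * g n2 c2 t2).

(** All indices of nonzero terms have height at most the total height of the
    factors, so the four sums may be taken over one finite list [E]. *)
Lemma ihall_mul E l1 l2 m1 m2 : uniq E ->
  (forall n, height (dvec n) <= height (dvec l1) + height (dvec l2)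
                                + height (dvec m1) + height (dvec m2) -> n \in E) ->
  ihall_u l1 l2 * ihall_u m1 m2 =
  \sum_(t1 <- E) \sum_(t2 <- E) \sum_(n1 <- E) \sum_(n2 <- E)
  \sum_(c1 <- E) \sum_(c2 <- E) \sum_(d1 <- E) \sum_(d2 <- E)
    ihall_coef l1 l2 m1 m2 t1 t2 n1 n2 c1 c2 d1 d2 *: (ihall_K (dvec d1) (dvec d2) * ihall_u t1 t2).
Proof.
move=> uE inE'; rewrite /ihall_u ih_uu.
have nz := root_neq0 hd.
pose G (t n c d : mults (dbl Q)) : H :=
  (v ^ (euler (dvec d) (dvec t) - euler (dvec (rho_m (swap Q) d)) (dvec t)
            - euler (dvec (mpair l1 l2)) (dvec (mpair m1 m2)) + euler (dvec n) (dvec c) *+ 2)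
       * inK (ha hd2 d) * inK (hf hd2 d n (mpair l1 l2))
       * inK (hf hd2 c (rho_m (swap Q) d) (mpair m1 m2))
       * inK (hg hd2 n c t)) *: (ih_K H (dvec d) * ih_u H t).
have GE t1 t2 n1 n2 c1 c2 d1 d2 :
    G (mpair t1 t2) (mpair n1 n2) (mpair c1 c2) (mpair d1 d2) =
    ihall_coef l1 l2 m1 m2 t1 t2 n1 n2 c1 c2 d1 d2 *: (ihall_K (dvec d1) (dvec d2) * ihall_u t1 t2).
  rewrite /G /ihall_coef (rho_mpair nz) !dvec_mpair !euler_dbl.
  by rewrite !(hf_mpair hd hd2) (hg_mpair hd hd2) (ha_mpair hd hd2).
have supp t1 t2 n1 n2 c1 c2 d1 d2 :
    ihall_coef l1 l2 m1 m2 t1 t2 n1 n2 c1 c2 d1 d2 != 0 ->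
    [/\ (t1 \in E) && (t2 \in E), (n1 \in E) && (n2 \in E),
        (c1 \in E) && (c2 \in E) & (d1 \in E) && (d2 \in E)].
  move=> /factors_neq0[[f1 f2] [f3 f4] [g1 g2]].
  have := congr1 (@height Q) (hf_dvec f1); have := congr1 (@height Q) (hf_dvec f2).
  have := congr1 (@height Q) (hf_dvec f3); have := congr1 (@height Q) (hf_dvec f4).
  have := congr1 (@height Q) (hg_dvec g1); have := congr1 (@height Q) (hg_dvec g2).
  rewrite !heightD.
  have h := height_ge0 nz; have := h d1; have := h d2; have := h c1; have := h c2.
  have := h n1; have := h n2.
  by move=> *; split; apply/andP; split; apply: inE'; lia.
have zero (V : lmodType K) (k : K) (x : V) : ~~ (k != 0) -> k *: x = 0.
  by rewrite negbK => /eqP ->; rewrite scale0r.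
rewrite (fsum_dbl nz (E := E)) // => [|t1 t2 tE]; last first.
  apply: fsum0 => n; apply: fsum0 => c; apply: fsum0 => d.
  have [n1 [n2 ->]] := mpair_surj n; have [c1 [c2 ->]] := mpair_surj c.
  have [d1 [d2 ->]] := mpair_surj d; rewrite -/(G _ _ _ _) GE.
  by apply: zero; apply: contra tE => /supp[].
apply: eq_bigr => t1 _; apply: eq_bigr => t2 _.
rewrite (fsum_dbl nz (E := E)) // => [|n1 n2 nE]; last first.
  apply: fsum0 => c; apply: fsum0 => d.
  have [c1 [c2 ->]] := mpair_surj c.
  have [d1 [d2 ->]] := mpair_surj d; rewrite -/(G _ _ _ _) GE.
  by apply: zero; apply: contra nE => /supp[].
apply: eq_bigr => n1 _; apply: eq_bigr => n2 _.
rewrite (fsum_dbl nz (E := E)) // => [|c1 c2 cE]; last first.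
  apply: fsum0 => d.
  have [d1 [d2 ->]] := mpair_surj d; rewrite -/(G _ _ _ _) GE.
  by apply: zero; apply: contra cE => /supp[].
apply: eq_bigr => c1 _; apply: eq_bigr => c2 _.
rewrite (fsum_dbl nz (E := E)) // => [|d1 d2 dE]; last first.
  rewrite -/(G _ _ _ _) GE.
  by apply: zero; apply: contra dE => /supp[].
by apply: eq_bigr => d1 _; apply: eq_bigr => d2 _; rewrite -/(G _ _ _ _) GE.
Qed.

End IHall.

(** ** The double of the extended Hall algebra *)

Section Bilinear.

Variables (U V W : lmodType K) (h : U -> V -> W).
Hypothesis hP : bilinear_map h.

Lemma bilinearZl k x y : h (k *: x) y = k *: h x y.
Proof. exact: (@linear_scale _ _ (fun x => h x y) _ _ (hP.2 y)). Qed.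

Lemma bilinearZr k x y : h x (k *: y) = k *: h x y.
Proof. exact: (@linear_scale _ _ (h x) _ _ (hP.1 x)). Qed.

Lemma bilinear_suml (T : Type) (s : seq T) (k : T -> K) (x : T -> U) y :
  h (\sum_(t <- s) k t *: x t) y = \sum_(t <- s) k t *: h (x t) y.
Proof. exact: (@linear_lsum _ _ (fun x => h x y) _ _ _ _ (hP.2 y)). Qed.

Lemma bilinear_sumr (T : Type) (s : seq T) (k : T -> K) x (y : T -> V) :
  h x (\sum_(t <- s) k t *: y t) = \sum_(t <- s) k t *: h x (y t).
Proof. exact: (@linear_lsum _ _ (h x) _ _ _ _ (hP.1 x)). Qed.

End Bilinear.

Section ExtHall.
Variables (Q : quiver) (hd : hall_data Q) (B : ext_hall hd).
Implicit Types (l m n c d t : mults Q) (a b : zvec Q).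

Local Notation f l m n := (inK (hf hd l m n)).
Local Notation g l m n := (inK (hg hd l m n)).
Local Notation A l := (inK (ha hd l)).
Local Notation eu := (eh_u B).
Local Notation eK := (eh_K B).

Lemma ext_uK a l : eu l * eK a = v ^ (- sform a (dvec l)) *: (eK a * eu l).
Proof. by rewrite eh_Ku scalerA v_exprNK scale1r. Qed.

Lemma ext_KuK b d (n : zvec Q) : eK b * eu d * eK n = v ^ sform b (dvec d) *: (eu d * eK (b + n)).
Proof. by rewrite eh_Ku -scalerAl -mulrA eh_KK. Qed.

Lemma ext_KuKuK b n b' c (x : zvec Q) :
  eK b * eu n * (eK b' * eu c * eK x) =
  v ^ (- (sform b' (dvec n) + sform x (dvec n + dvec c)))
    *: (eK (b + b' + x) * (eu n * eu c)).
Proof.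
have -> : eK b' * eu c * eK x = v ^ (- sform x (dvec c)) *: (eK (b' + x) * eu c).
  by rewrite -mulrA ext_uK -scalerAr mulrA eh_KK.
rewrite -scalerAr -[eK b * eu n * _]mulrA [eu n * (_ * _)]mulrA ext_uK -scalerAl -scalerAr.
rewrite scalerA v_exprD -[_ * eu n * eu c]mulrA [eK b * (_ * _)]mulrA eh_KK addrA.
by congr (v ^ _ *: _); rewrite sformDl sformDr; lia.
Qed.

Lemma pairing_left b d (n : zvec Q) a d' :
  eh_phi (eK b * eu d * eK n) (eK a * eu d') =
  v ^ (sform b (dvec d) + sform a (dvec d') + sform (b + n) a) * A d * (d == d')%:R.
Proof.
rewrite ext_KuK eh_Ku (bilinearZl (eh_phi_bilinear B)) (bilinearZr (eh_phi_bilinear B)) eh_phiE.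
rewrite scalerA v_exprD; move: (A d) ((d == d')%:R : K) => y z.
by rewrite -[_ *: _]/(_ * _) !mulrA v_exprD mulrAC.
Qed.

Lemma pairing_right b d' a d (n : zvec Q) :
  eh_phi (eK b * eu d') (eK a * eu d * eK n) =
  v ^ (sform b (dvec d') + sform a (dvec d) + sform b (a + n)) * A d' * (d == d')%:R.
Proof.
rewrite ext_KuK eh_Ku (bilinearZl (eh_phi_bilinear B)) (bilinearZr (eh_phi_bilinear B)) eh_phiE.
rewrite scalerA v_exprD eq_sym; move: (A d') ((d == d')%:R : K) => y z.
by rewrite -[_ *: _]/(_ * _) !mulrA v_exprD mulrAC.
Qed.

(** The multiplication of the double refers to coproducts expanded as finite lists
    of pure tensors; this is the expansion used for each of the four factors. *)
Lemma coproduct_Ku E b l : uniq E ->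
  (forall n, height (dvec n) <= height (dvec l) -> n \in E) ->
  eh_Delta B (eK b * eu l) =
  \sum_(p <- [seq ((v ^ euler (dvec m) (dvec n) * f m n l) *: (eK b * eu m * eK (dvec n)),
                   eK b * eu n) | m <- E, n <- E]) eh_tens p.1 p.2.
Proof.
move=> uE inE'; rewrite rmorphM /= eh_Delta_K eh_Delta_u big_allpairs_dep.
have nz := root_neq0 hd.
have supp m n : ~~ ((m \in E) && (n \in E)) -> f m n l = 0.
  apply: contraNeq => /hf_dvec/(congr1 (@height Q)); rewrite heightD => h.
  have hm := height_ge0 nz m; have hn := height_ge0 nz n.
  by apply/andP; split; apply: inE'; lia.
rewrite (fsum_seq uE) => [|m mE]; last first.
  by apply: fsum0 => n; rewrite supp ?(negbTE mE) // mulr0 scale0r.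
rewrite mulr_sumr; apply: eq_bigr => m _.
rewrite (fsum_seq uE) => [|n nE]; last first.
  by rewrite supp ?(negbTE nE) ?andbF // mulr0 scale0r.
rewrite mulr_sumr; apply: eq_bigr => n _.
rewrite -scalerAr eh_tensM (bilinearZl (eh_tensP B).1) /=.
by rewrite mulrA.
Qed.

Lemma ext_mul E n c : uniq E ->
  (forall t, height (dvec t) <= height (dvec n) + height (dvec c) -> t \in E) ->
  eu n * eu c = \sum_(t <- E) (v ^ euler (dvec n) (dvec c) * g n c t) *: eu t.
Proof.
move=> uE inE'; rewrite eh_uu (fsum_seq uE) // => t tE.
suff -> : g n c t = 0 by rewrite mulr0 scale0r.
apply: contraNeq tE => /hg_dvec/(congr1 (@height Q)); rewrite heightD => h.
by apply: inE'; rewrite h.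
Qed.

Section Double.
Variable D : hall_double B.
Local Notation ten := (dd_tens D).
Let tenP := (dd_tensP D).1.

(** The value of the isomorphism at K_(a,b) * u_(l,m).  With K on the left of u, the
    power of v depends on the lattice elements only. *)
Definition Phi_value a b l m : D := v ^ sform a b *: ten (eK b * eu l) (eK a * eu m).

(** The contribution of one choice of terms in the four coproducts whose pairings
    do not vanish: [d1] is paired with [d1], and [d2] with [d2]. *)
Definition double_term a b a' b' l1 l2 m1 m2 d1 n1 d2 n2 c1 c2 : D :=
  ((v ^ euler (dvec d1) (dvec n1) * f d1 n1 l1) *
   (v ^ euler (dvec d2) (dvec n2) * f d2 n2 l2) *
   (v ^ euler (dvec c1) (dvec d2) * f c1 d2 m1) *
   (v ^ euler (dvec c2) (dvec d1) * f c2 d1 m2) *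
   (v ^ (sform b (dvec d1) + sform a' (dvec d1) + sform (b + dvec n1) a') * A d1) *
   (v ^ (sform b' (dvec d2) + sform a (dvec d2) + sform b' (a + dvec n2)) * A d2))
  *: ten (eK b * eu n1 * (eK b' * eu c1 * eK (dvec d2)))
         (eK a * eu n2 * (eK a' * eu c2 * eK (dvec d1))).

Lemma scalar_shuffle (R : comPzRingType) (x y z w p q s t : R) :
  y * q * (x * p * s) * t * (z * w) = t * s * (x * y * z * w * p * q).
Proof. by ring. Qed.

(** Four coproducts give eight indices, and the two pairings identify two couples
    of them. *)
Lemma double_mul E a b a' b' l1 l2 m1 m2 : uniq E ->
  (forall n, height (dvec n) <= height (dvec l1) + height (dvec l2)
                                + height (dvec m1) + height (dvec m2) -> n \in E) ->
  ten (eK b * eu l1) (eK a * eu l2) * ten (eK b' * eu m1) (eK a' * eu m2) =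
  \sum_(d1 <- E) \sum_(n1 <- E) \sum_(d2 <- E) \sum_(n2 <- E)
  \sum_(c1 <- E) \sum_(c2 <- E) double_term a b a' b' l1 l2 m1 m2 d1 n1 d2 n2 c1 c2.
Proof.
move=> uE inE'; have nz := root_neq0 hd.
have h1 := height_ge0 nz l1; have h2 := height_ge0 nz l2.
have h3 := height_ge0 nz m1; have h4 := height_ge0 nz m2.
have inE1 n : height (dvec n) <= height (dvec l1) -> n \in E by move=> ?; apply: inE'; lia.
have inE2 n : height (dvec n) <= height (dvec l2) -> n \in E by move=> ?; apply: inE'; lia.
have inE3 n : height (dvec n) <= height (dvec m1) -> n \in E by move=> ?; apply: inE'; lia.
have inE4 n : height (dvec n) <= height (dvec m2) -> n \in E by move=> ?; apply: inE'; lia.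
rewrite (dd_mul D (coproduct_Ku b uE inE1) (coproduct_Ku a uE inE2)
           (coproduct_Ku b' uE inE3) (coproduct_Ku a' uE inE4)).
rewrite big_allpairs_dep; apply: eq_big_seq => d1 d1E; apply: eq_bigr => n1 _.
rewrite big_allpairs_dep; apply: eq_big_seq => d2 d2E; apply: eq_bigr => n2 _.
rewrite big_allpairs_dep; apply: eq_bigr => c1 _.
(* The general term, before the pairings force d1' = d1 and d2' = d2. *)
pose X d2' d1' c2 : D :=
  ((v ^ euler (dvec d1) (dvec n1) * f d1 n1 l1) *
   (v ^ euler (dvec d2) (dvec n2) * f d2 n2 l2) *
   (v ^ euler (dvec c1) (dvec d2') * f c1 d2' m1) *
   (v ^ euler (dvec c2) (dvec d1') * f c2 d1' m2) *
   (v ^ (sform b (dvec d1) + sform a' (dvec d1') + sform (b + dvec n1) a') * A d1) *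
   (v ^ (sform b' (dvec d2') + sform a (dvec d2) + sform b' (a + dvec n2)) * A d2'))
  *: ten (eK b * eu n1 * (eK b' * eu c1 * eK (dvec d2')))
         (eK a * eu n2 * (eK a' * eu c2 * eK (dvec d1'))).
transitivity (\sum_(d2' <- E) (d2 == d2')%:R *: (\sum_(c2 <- E) \sum_(d1' <- E)
                (d1 == d1')%:R *: X d2' d1' c2)); last first.
  by rewrite sum_delta //; apply: eq_bigr => c2 _; rewrite sum_delta.
apply: eq_bigr => d2' _; rewrite big_allpairs_dep scaler_sumr.
apply: eq_bigr => c2 _; rewrite scaler_sumr; apply: eq_bigr => d1' _ /=.
rewrite (bilinearZl (eh_phi_bilinear B)) (bilinearZr (eh_phi_bilinear B)).
rewrite pairing_left pairing_right -!scalerAr (bilinearZl tenP) (bilinearZr tenP) !scalerA.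
congr (_ *: _); rewrite /GRing.scale /=; exact: scalar_shuffle.
Qed.

End Double.
End ExtHall.

(** ** The isomorphism *)

Lemma mulf_neq0_inv (R : idomainType) (x y : R) : x * y != 0 -> x != 0 /\ y != 0.
Proof. by rewrite mulf_eq0 negb_or => /andP. Qed.

Section Comparison.
Variables (Q : quiver) (hd : hall_data Q) (hd2 : hall_data (dbl Q)).
Variables (H : iHall_algebra hd2 (swap Q)) (B : ext_hall hd) (D : hall_double B).
Implicit Types (l m n c d t : mults Q) (a b : zvec Q).

Local Notation f l m n := (inK (hf hd l m n)).
Local Notation g l m n := (inK (hg hd l m n)).
Local Notation A l := (inK (ha hd l)).
Local Notation eu := (eh_u B).
Local Notation eK := (eh_K B).
Local Notation ten := (dd_tens D).
Let tenP := (dd_tensP D).1.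

Lemma zero_shuffle (R : comPzRingType) (x1 x2 x3 x4 y z f1 f2 f3 f4 : R) :
  x1 * f1 * (x2 * f2) * (x3 * f3) * (x4 * f4) * y * z =
  x1 * x2 * x3 * x4 * y * z * (f1 * f2 * (f3 * f4)).
Proof. by ring. Qed.

Lemma collect_double (R : comPzRingType) (s x1 x2 x3 x4 x5 x6 p1 p2 q1 q2
    f1 f2 f3 f4 A1 A2 g1 g2 : R) :
  s * ((x1 * f1) * (x2 * f2) * (x3 * f3) * (x4 * f4) * (x5 * A1) * (x6 * A2))
    * (p1 * p2) * ((q1 * g1) * (q2 * g2)) =
  (s * x1 * x2 * x3 * x4 * x5 * x6 * p1 * p2 * q1 * q2)
    * (A1 * A2 * (f1 * f2) * (f3 * f4) * (g1 * g2)).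
Proof. by ring. Qed.

Lemma collect_ihall (R : comPzRingType) (y e z f1 f2 f3 f4 A1 A2 g1 g2 : R) :
  y * (e * (A1 * A2) * (f1 * f2) * (f3 * f4) * (g1 * g2)) * z =
  (y * e * z) * (A1 * A2 * (f1 * f2) * (f3 * f4) * (g1 * g2)).
Proof. by ring. Qed.

(** The products u_n1 * u_c1 and u_n2 * u_c2 bring in the two polynomials [g].  Unless
    one of the six Hall polynomials vanishes, the dimension vectors satisfy
    l1 = d1 + n1, l2 = d2 + n2, m1 = c1 + d2, m2 = c2 + d1, t1 = n1 + c1 and
    t2 = n2 + c2; under these relations the exponents of v on the two sides are
    equal by bilinearity of the Euler form. *)
Lemma term_match E a b a' b' l1 l2 m1 m2 d1 n1 d2 n2 c1 c2 : uniq E ->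
  (forall n, height (dvec n) <= height (dvec l1) + height (dvec l2)
                                + height (dvec m1) + height (dvec m2) -> n \in E) ->
  v ^ (sform a b + sform a' b') *: double_term D a b a' b' l1 l2 m1 m2 d1 n1 d2 n2 c1 c2 =
  \sum_(t1 <- E) \sum_(t2 <- E)
    (v ^ (sform a' (dvec l1) + sform b' (dvec l2) - sform b' (dvec l1) - sform a' (dvec l2))
     * ihall_coef hd l1 l2 m1 m2 t1 t2 n1 n2 c1 c2 d1 d2)
    *: Phi_value D (a + a' + dvec d1) (b + b' + dvec d2) t1 t2.
Proof.
move=> uE inE'.
have [f0|fn0] := eqVneq ((f d1 n1 l1 * f d2 n2 l2) * (f c1 d2 m1 * f c2 d1 m2)) 0.
  rewrite /double_term big1 => [|t1 _].
    set k := (X in X *: ten _ _).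
    suff -> : k = 0 by rewrite scale0r scaler0.
    by rewrite /k zero_shuffle f0 mulr0.
  rewrite big1 // => t2 _; rewrite /ihall_coef.
  by rewrite -(mulrA _ (f d1 n1 l1 * _)) f0 mulr0 mul0r mulr0 scale0r.
have [/mulf_neq0_inv[f1 f2] /mulf_neq0_inv[f3 f4]] := mulf_neq0_inv fn0.
have El1 := hf_dvec f1; have El2 := hf_dvec f2.
have Em1 := hf_dvec f3; have Em2 := hf_dvec f4.
have nz := root_neq0 hd.
have hd1 := height_ge0 nz d1; have hd2' := height_ge0 nz d2.
have hn1 := height_ge0 nz n1; have hn2 := height_ge0 nz n2.
have hc1 := height_ge0 nz c1; have hc2 := height_ge0 nz c2.
rewrite El1 El2 Em1 Em2 !heightD in inE'.
rewrite /double_term !ext_KuKuK (@ext_mul _ _ _ E) // => [|t ht]; last by apply: inE'; lia.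
rewrite (@ext_mul _ _ _ E) // => [|t ht]; last by apply: inE'; lia.
rewrite (bilinearZl tenP) (bilinearZr tenP) !mulr_sumr.
under [X in ten X _]eq_bigr do rewrite -scalerAr.
under [X in ten _ X]eq_bigr do rewrite -scalerAr.
rewrite (bilinear_suml tenP) !scaler_sumr; apply: eq_bigr => t1 _.
rewrite (bilinear_sumr tenP) !scaler_sumr; apply: eq_bigr => t2 _.
rewrite /Phi_value !scalerA /ihall_coef collect_double collect_ihall !v_exprD.
have [->|/mulf_neq0_inv[g1 g2]] := eqVneq (g n1 c1 t1 * g n2 c2 t2) 0; first by rewrite !mulr0 !scale0r.
have Et1 := hg_dvec g1; have Et2 := hg_dvec g2.
congr (v ^ _ * _ *: _).
rewrite El1 El2 Em1 Em2 Et1 Et2 /sform !(eulerDl, eulerDr).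
lia.
Qed.

End Comparison.

Section Isomorphism.
Variables (Q : quiver) (hd : hall_data Q) (hd2 : hall_data (dbl Q)).
Variables (H : iHall_algebra hd2 (swap Q)) (B : ext_hall hd) (D : hall_double B).
Implicit Types (l m n c d t : mults Q) (a b : zvec Q).

Local Notation eu := (eh_u B).
Local Notation eK := (eh_K B).
Local Notation ten := (dd_tens D).
Let tenP := (dd_tensP D).1.

Lemma linear_mul (V : algType K) (W : lmodType K) (F : V -> W) (x : V) :
  linear F -> linear (fun y => F (x * y)) /\ linear (fun y => F (y * x)).
Proof.
by move=> lF; split=> k y z; rewrite ?mulrDr ?mulrDl -?scalerAr -?scalerAl lF.
Qed.

Lemma ihall_basis : is_basis (fun i : zvec (dbl Q) * mults (dbl Q) => ih_K H i.1 * ih_u H i.2).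
Proof. exact: ih_basis. Qed.

Lemma basis_index (i : zvec (dbl Q) * mults (dbl Q)) :
  exists a b l m, ih_K H i.1 * ih_u H i.2 = ihall_K H a b * ihall_u H l m.
Proof.
case: i => x n; have [l [m ->]] := mpair_surj n.
by exists (zres1 x), (zres2 x), l, m; rewrite /ihall_K zresE.
Qed.

Lemma exists_Phi : exists Phi : H -> D,
  linear Phi /\ forall a b l m, Phi (ihall_K H a b * ihall_u H l m) = Phi_value D a b l m.
Proof.
have nz := root_neq0 hd.
have /choice[split_m split_mE] (n : mults (dbl Q)) :
    exists lm : mults Q * mults Q, n = mpair lm.1 lm.2.
  by have [l [m ->]] := mpair_surj n; exists (l, m).
have [Phi [lPhi PhiE]] := basis_extend ihall_basis (fun i =>
  Phi_value D (zres1 i.1) (zres2 i.1) (split_m i.2).1 (split_m i.2).2).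
exists Phi; split=> // a b l m; rewrite (PhiE (zin1 a + zin2 b, mpair l m)) /=.
have [<- <-] := mpair_inj nz (split_mE (mpair l m)).
by rewrite zres1K zres2K.
Qed.

Section Phi.
Variable Phi : H -> D.
Hypotheses (lPhi : linear Phi)
  (PhiE : forall a b l m, Phi (ihall_K H a b * ihall_u H l m) = Phi_value D a b l m).

Lemma Phi_basisM a b l1 l2 a' b' m1 m2 :
  Phi ((ihall_K H a b * ihall_u H l1 l2) * (ihall_K H a' b' * ihall_u H m1 m2)) =
  Phi_value D a b l1 l2 * Phi_value D a' b' m1 m2.
Proof.
have nz := root_neq0 hd.
have h1 := height_ge0 nz l1; have h2 := height_ge0 nz l2.
have h3 := height_ge0 nz m1; have h4 := height_ge0 nz m2.
pose h := height (dvec l1) + height (dvec l2) + height (dvec m1) + height (dvec m2).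
have [E [uE inE']] := bounded_mults nz `|h|%N.
have hE n : height (dvec n) <= h -> n \in E.
  by move=> nh; apply: inE'; rewrite gez0_abs // /h; lia.
rewrite /Phi_value -scalerAl -scalerAr scalerA v_exprD (double_mul _ _ _ _ _ uE hE).
rewrite -mulrA [ihall_u H l1 l2 * _]mulrA ihall_uK -scalerAl -scalerAr -mulrA (ihall_mul hd H uE hE).
rewrite sum_reorder (linear_scale _ _ lPhi) mulrA ihall_KK.
pose F x := Phi (ihall_K H (a + a') (b + b') * x); rewrite -/(F _).
have lF : linear F := (linear_mul _ lPhi).1.
do 6 (rewrite (linear_bigsum _ _ lF) !scaler_sumr; apply: eq_bigr => ? _).
rewrite (term_match D _ _ _ _ _ _ _ _ _ _ uE hE).
rewrite (linear_bigsum _ _ lF) !scaler_sumr; apply: eq_bigr => t1 _.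
rewrite (linear_bigsum _ _ lF) !scaler_sumr; apply: eq_bigr => t2 _.
by rewrite (linear_scale _ _ lF) scalerA /F mulrA ihall_KK PhiE.
Qed.

Lemma Phi_mul x y : Phi (x * y) = Phi x * Phi y.
Proof.
have lid (V : lmodType K) : linear (id : V -> V) by [].
move: x; apply: (basis_eq ihall_basis).
- exact: (linear_mul y lPhi).2.
- by move=> k z w; rewrite lPhi mulrDl scalerAl.
move=> i; have [a [b [l1 [l2 ->]]]] := basis_index i.
move: y; apply: (basis_eq ihall_basis).
- exact: (linear_mul _ lPhi).1.
- by move=> k z w; rewrite lPhi mulrDr scalerAr.
move=> j; have [a' [b' [m1 [m2 ->]]]] := basis_index j.
by rewrite Phi_basisM !PhiE.
Qed.

Lemma Phi_valueE a b l m : Phi_value D a b l m =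
  v ^ (sform a b + sform b (dvec l) + sform a (dvec m)) *: ten (eu l * eK b) (eu m * eK a).
Proof. by rewrite /Phi_value !eh_Ku (bilinearZl tenP) (bilinearZr tenP) !scalerA !v_exprD addrA. Qed.

Lemma Phi_formula l m a b :
  Phi (ih_u H (mpair l m) * ih_K H (zin1 a) * ih_K H (zin2 b)) =
  v ^ (sform (dvec m + a) (dvec l + b) - sform (dvec l) (dvec m))
  *: ten (eu l * eK b) (eu m * eK a).
Proof.
rewrite -mulrA ih_KK -/(ihall_u H l m) -/(ihall_K H a b) ihall_uK (linear_scale _ _ lPhi) PhiE.
rewrite Phi_valueE scalerA v_exprD; congr (v ^ _ *: _).
by rewrite !(sformDl, sformDr) (sformC (dvec m) (dvec l)) (sformC (dvec m) b); lia.
Qed.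

(** The inverse is prescribed on the tensors of basis elements of the extended Hall
    algebra and exists by the universal property of the tensor product. *)
Lemma Phi_inverse : exists Psi : D -> H, cancel Phi Psi /\ cancel Psi Phi.
Proof.
have bB := @eh_basis _ _ B.
have [h [hP hE]] := bilinear_extend (fun i j : mults Q * zvec Q =>
  v ^ (- (sform j.2 i.2 + sform i.2 (dvec i.1) + sform j.2 (dvec j.1)))
    *: (ihall_K H j.2 i.2 * ihall_u H i.1 j.1)) bB bB.
have [[Psi PsiE] _] := (dd_tensP D).2 H h hP.
have lPsi : linear Psi by exact: linearP.
exists Psi; split.
  apply: (basis_eq ihall_basis) => [k x y|//|i]; first by rewrite lPhi lPsi.
  have [a [b [l [m ->]]]] := basis_index i.
  rewrite PhiE Phi_valueE (linear_scale _ _ lPsi) PsiE (hE (l, b) (m, a)) /= scalerA v_exprD.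
  by rewrite addrN scale1r.
pose PP : {linear D -> D} := HB.pack (fun x => Phi (Psi x))
  (GRing.isLinear.Build _ _ _ _ (fun x => Phi (Psi x))
     (fun k x y => etrans (congr1 Phi (lPsi k x y)) (lPhi k _ _))).
have [_ uniq_lin] := (dd_tensP D).2 D ten tenP.
move=> z; apply: (uniq_lin PP idfun) => x y /=; rewrite PsiE.
move: x; apply: (basis_eq bB).
- by move=> k x x'; rewrite (hP.2 y) lPhi.
- exact: tenP.2.
move=> i; move: y; apply: (basis_eq bB).
- by move=> k y y'; rewrite (hP.1 _) lPhi.
- exact: tenP.1.
by move=> j; rewrite hE (linear_scale _ _ lPhi) PhiE Phi_valueE scalerA v_exprD addNr scale1r.
Qed.

End Phi.
End Isomorphism.

Theorem proposition4p3 (Q : quiver) (hQ : dynkin Q)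
    (hd : hall_data Q) (hd2 : hall_data (dbl Q))
    (H : iHall_algebra hd2 (swap Q))
    (B : ext_hall hd) (D : hall_double B) :
  exists Phi : {lrmorphism H -> D},
    bijective Phi /\
    forall (l m : mults Q) (a b : zvec Q),
      Phi (ih_u H (mpair l m) * ih_K H (zin1 a) * ih_K H (zin2 b)) =
      v ^ (sform (dvec m + a) (dvec l + b) - sform (dvec l) (dvec m))
      *: dd_tens D (eh_u B l * eh_K B b) (eh_u B m * eh_K B a).
Proof.
have [Phi [lPhi PhiE]] := exists_Phi H D.
have PhiM := Phi_mul lPhi PhiE.
have [Psi [PhiK PsiK]] := Phi_inverse lPhi PhiE.
(* A multiplicative surjection maps the unit to a unit. *)
have Phi1 : Phi 1 = 1 by rewrite -[LHS]mulr1 -[in LHS](PsiK 1) -PhiM mul1r.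
pose F : {lrmorphism H -> D} := HB.pack Phi
  (GRing.isLinear.Build _ _ _ _ Phi lPhi)
  (GRing.isMonoidMorphism.Build _ _ Phi (Phi1, PhiM)).
exists F; split; first by exists Psi.
exact: Phi_formula lPhi PhiE.
Qed.
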